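(* Let $P^{\rm c}_{\rm s}, P^{\rm c}_{\rm w}, P^{\rm c}_{\rm r}, P_{\rm s}, P_{\rm w}, P_{\rm r}\subset[1,\infty]$ be sets satisfying: (i) each of them is of the form $\{\infty\}$, $[p_0,\infty]$ or $(p_0,\infty]$ for some $p_0\in[1,\infty)$; (ii) $P_{\rm s}\subset P^{\rm c}_{\rm s}$, $P_{\rm w}\subset P^{\rm c}_{\rm w}$, $P_{\rm r}\subset P^{\rm c}_{\rm r}$, $P^{\rm c}_{\rm s}\subset P^{\rm c}_{\rm w}\subset P^{\rm c}_{\rm r}\subset \overline{P^{\rm c}_{\rm s}}$ and $P_{\rm s}\subset P_{\rm w}\subset P_{\rm r}\subset\overline{P_{\rm s}}$, where $\overline{E}$ is the closure of $E$ in the usual topology of $\mathbb{R}\cup\{\infty\}$; (iii) if $P^{\rm c}_{\rm r}=[1,\infty]$ then $P^{\rm c}_{\rm w}=[1,\infty]$, and if $P_{\rm r}=[1,\infty]$ then $P_{\rm w}=[1,\infty]$. Then there exists a nondoubling metric measure space $\mathfrak{Z}$ such that: $\mathcal{M}^{\rm c}_{\mathfrak Z}$ is of strong (respectively weak, restricted weak) type $(p,p)$ if and only if $p\in P^{\rm c}_{\rm s}$ (respectively $p\in P^{\rm c}_{\rm w}$, $p\in P^{\rm c}_{\rm r}$), and $\mathcal{M}_{\mathfrak Z}$ is of strong (respectively weak, restricted weak) type $(p,p)$ if and only if $p\in P_{\rm s}$ (respectively $p\in P_{\rm w}$, $p\in P_{\rm r}$).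
   Context: A metric measure space $\mathfrak X=(X,\rho,\mu)$ consists of a nonempty set $X$, a metric $\rho$ and a nonnegative Borel measure $\mu$; it is assumed that every open ball $B(x,s)=\{y:\rho(x,y)<s\}$ has finite strictly positive measure. $\mathfrak X$ is doubling if there is $C$ with $\mu(B(x,2s))\le C\mu(B(x,s))$ for all $x\in X$, $s>0$. For $f$ integrable on every ball, the centered and noncentered Hardy–Littlewood maximal operators are $\mathcal M^{\rm c}_{\mathfrak X}f(x)=\sup_{s>0}\frac1{\mu(B(x,s))}\int_{B(x,s)}|f|\,d\mu$ and $\mathcal M_{\mathfrak X}f(x)=\sup_{B\ni x}\frac1{\mu(B)}\int_B|f|\,d\mu$ (sup over open balls containing $x$). An operator $T$ is of strong type $(p,p)$, $p\in[1,\infty]$, if $\|Tf\|_p\lesssim\|f\|_p$ on $L^p$; of weak type $(p,p)$, $p<\infty$, if $\lambda\,\mu(\{|Tf|>\lambda\})^{1/p}\lesssim\|f\|_p$ uniformly in $f\in L^p$, $\lambda>0$ (weak type $(\infty,\infty)$ means strong type $(\infty,\infty)$); of restricted weak type $(p,p)$, for $p\in(1,\infty)$, if $\lambda\,\mu(\{|T\mathbf 1_E|>\lambda\})^{1/p}\lesssim \mu(E)^{1/p}$ uniformly in measurable $E$ with $\mu(E)<\infty$ and $\lambda>0$; restricted weak type $(1,1)$ means weak type $(1,1)$, and restricted weak type $(\infty,\infty)$ means boundedness on $L^\infty$. *)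

(* Defs.v *)
From HB Require Import structures.
From mathcomp Require Import all_boot all_order all_algebra.
From mathcomp Require Import all_classical all_reals all_analysis.
From mathcomp Require Import lebesgue_measure measurable_realfun.
Set Implicit Arguments. Unset Strict Implicit. Unset Printing Implicit Defensive.
Import Order.TTheory GRing.Theory Num.Theory.
Local Open Scope classical_set_scope.
Local Open Scope ring_scope.

Section MMS.
Context {R : realType} {d : measure_display} {X : measurableType d}.
Variables (rho : X -> X -> R) (mu : {measure set X -> \bar R}).

Definition rball (x : X) (s : R) : set X := [set y | rho x y < s].

Definition is_metric : Prop :=
  [/\ forall x y, 0 <= rho x y,
      forall x y, rho x y = 0 <-> x = y,
      forall x y, rho x y = rho y x &
      forall x y z, rho x z <= rho x y + rho y z].

Definition rho_open (A : set X) : Prop :=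
  forall x, A x -> exists2 r : R, 0 < r & rball x r `<=` A.

Definition metric_measure_space : Prop :=
  [/\ is_metric,
      (forall A : set X, measurable A <-> smallest (sigma_algebra setT) rho_open A) &
      (forall x s, 0 < s -> (0 < mu (rball x s))%E /\ (mu (rball x s) < +oo)%E)].

Definition doubling : Prop :=
  exists C : R, forall x s, 0 < s ->
    (mu (rball x (2 * s)) <= C%:E * mu (rball x s))%E.

Definition avg (B : set X) (f : X -> R) : \bar R :=
  (((fine (mu B))^-1)%:E * \int[mu]_(y in B) (`|f y|)%:E)%E.

Definition Mcent (f : X -> R) (x : X) : \bar R :=
  ereal_sup [set avg (rball x s) f | s in [set s : R | 0 < s]].

Definition Mnoncent (f : X -> R) (x : X) : \bar R :=
  ereal_sup [set a | exists y : X, exists2 s : R,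
               0 < s /\ rho y x < s & a = avg (rball y s) f].

(* outer measure (used for level sets, which need not be measurable) *)
Definition omeas (A : set X) : \bar R :=
  ereal_inf [set mu B | B in [set B | measurable B /\ A `<=` B]].

Definition uint (h : X -> \bar R) : \bar R :=
  ereal_inf [set (\int[mu]_y g y)%E |
             g in [set g : X -> \bar R | measurable_fun [set: X] g /\ forall y, (h y <= g y)%E]].

Definition pnorm (p : \bar R) (h : X -> \bar R) : \bar R :=
  match p with
  | +oo%E => ereal_inf [set M : \bar R | omeas [set y | (M < h y)%E] = 0%E]
  | p'%:E => poweR (uint (fun y => poweR (h y) p')) p'^-1
  | -oo%E => 0%E
  end.

Definition absE (f : X -> R) : X -> \bar R := fun y => (`|f y|)%:E.

Definition in_Lp (p : \bar R) (f : X -> R) : Prop :=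
  measurable_fun [set: X] f /\ (pnorm p (absE f) < +oo)%E.

Definition strong_type (T : (X -> R) -> X -> \bar R) (p : \bar R) : Prop :=
  exists C : R, forall f, in_Lp p f -> (pnorm p (T f) <= C%:E * pnorm p (absE f))%E.

Definition weak_type (T : (X -> R) -> X -> \bar R) (p : \bar R) : Prop :=
  match p with
  | +oo%E => strong_type T +oo%E
  | p'%:E => exists C : R, forall f, in_Lp p f -> forall lam : R, 0 < lam ->
      (lam%:E * poweR (omeas [set y | (lam%:E < T f y)%E]) p'^-1
        <= C%:E * pnorm p (absE f))%E
  | -oo%E => False
  end.

Definition indic (E : set X) : X -> R := fun y => if `[< E y >] then 1 else 0.

Definition restricted_weak_type (T : (X -> R) -> X -> \bar R) (p : \bar R) : Prop :=
  match p with
  | +oo%E => strong_type T +oo%E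
  | p'%:E => if p' == 1 then weak_type T p else
      exists C : R, forall E : set X, measurable E -> (mu E < +oo)%E ->
      forall lam : R, 0 < lam ->
      (lam%:E * poweR (omeas [set y | (lam%:E < T (indic E) y)%E]) p'^-1
        <= C%:E * poweR (mu E) p'^-1)%E
  | -oo%E => False
  end.

End MMS.

Definition exp_set_form {R : realType} (P : set (\bar R)) : Prop :=
  P = [set +oo%E] \/
  exists2 p0 : R, 1 <= p0 &
    (P = [set q | (p0%:E <= q)%E] \/ P = [set q | (p0%:E < q)%E]).

Definition full_range {R : realType} : set (\bar R) := [set q | (1%:E <= q)%E].

(* Main.v *)
Require Import Defs.
From HB Require Import structures.
From mathcomp Require Import all_boot all_order all_algebra.
From mathcomp Require Import all_classical all_reals all_analysis.
From mathcomp Require Import lebesgue_measure measurable_realfun.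
From mathcomp Require Import ring lra.

(** A space at distances 0, 1, 2 is built from a centre of mass 1 and a sequence
    of finite blocks of summable mass.  A block has hubs and leaves, and every
    leaf [s] has a companion of negligible mass.  A ball is a point, or contains
    the centre (and then only the L^1 norm is averaged), or is the cell of a
    leaf: the leaf, its companion and the hubs adjacent to it.  Averages over
    cells carry mass from hubs to leaves, so that the type of the maximal
    operator at [p] is a bound, uniform in the blocks, for a transfer operator.
    The cell is always a ball centred at the companion; it is a ball centred at
    the leaf only if the leaf is not adjacent to the centre.  As companions have
    negligible mass, blocks whose leaves are adjacent to the centre are invisible
    to the centered operator, which decouples the two operators.

    Stars with leaves of mass [2 ^ j] give every threshold except for the one
    where only the restricted weak type holds at the endpoint [p0 > 1].  There, in
    a binary tree, the leaves receive a geometric series from the hubs above them;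
    for an indicator function the series is comparable to its largest term, but
    in general it is not. *)

Import Order.TTheory GRing.Theory Num.Theory.
Local Open Scope classical_set_scope.
Local Open Scope ring_scope.

Set Implicit Arguments. Unset Strict Implicit. Unset Printing Implicit Defensive.

(** * Transfer operators *)

Inductive kind := Strong | Weak | Restr.

Section Gauge.
Variable R : realType.
Implicit Types (p lam u v c : R) (kd : kind).

(** Integrated, it gives the p-th power of the L^p norm, or of the weak quantity at one level [lam],
    so one inequality uniform in [lam] covers every type. [Weak] and [Restr] differ only in the test
    functions allowed. *)
Definition gauge kd p lam u : R :=
  if kd is Strong then u `^ p else lam `^ p * (lam < u)%R%:R.

Lemma gauge_ge0 kd p lam u : 0 <= gauge kd p lam u.
Proof. by case: kd => /=; rewrite ?mulr_ge0 ?powR_ge0 ?ler0n. Qed.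

Lemma powR_mono p u v : 0 <= p -> 0 <= u -> u <= v -> u `^ p <= v `^ p.
Proof.
move=> p0 u0 uv; apply: ge0_ler_powR; rewrite ?nnegrE //.
exact: le_trans uv.
Qed.

Lemma gauge_le_powR kd p lam u : 0 < lam -> 0 <= p -> 0 <= u ->
  gauge kd p lam u <= u `^ p.
Proof.
move=> l0 p0 u0; case: kd => //=.
- case: ltP => lu; rewrite ?mulr1 ?mulr0 ?powR_ge0 //.
  by apply: powR_mono => //; exact: ltW.
- case: ltP => lu; rewrite ?mulr1 ?mulr0 ?powR_ge0 //.
  by apply: powR_mono => //; exact: ltW.
Qed.

Lemma gauge_mono kd p lam u v : 0 <= p -> 0 <= u -> u <= v ->
  gauge kd p lam u <= gauge kd p lam v.
Proof.
move=> p0 u0 uv; case: kd => /=; first exact: powR_mono.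
- rewrite ler_wpM2l ?powR_ge0 // ler_nat.
  by case: (ltP lam u) => // lu; rewrite (lt_le_trans lu uv).
- rewrite ler_wpM2l ?powR_ge0 // ler_nat.
  by case: (ltP lam u) => // lu; rewrite (lt_le_trans lu uv).
Qed.

Lemma gaugeZ kd p lam c u : 0 < c -> 0 <= u -> 0 < lam ->
  gauge kd p lam (c * u) = c `^ p * gauge kd p (lam / c) u.
Proof.
move=> c0 u0 l0.
have E : lam `^ p = c `^ p * (lam / c) `^ p.
  by rewrite -powRM ?divr_ge0 1?ltW // mulrC divfK // gt_eqF.
case: kd => /=; first by rewrite powRM // ltW.
- by rewrite ltr_pdivrMr // (mulrC u) mulrA -E.
- by rewrite ltr_pdivrMr // (mulrC u) mulrA -E.
Qed.

Lemma gauge_max kd p lam u v :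
  gauge kd p lam (Num.max u v) <= gauge kd p lam u + gauge kd p lam v.
Proof.
by case: (leP u v) => _; rewrite ?lerDl ?lerDr gauge_ge0.
Qed.

(** The sum is at most twice the maximum; the factor 2 is moved into the level. This stands in for
    the triangle inequality. *)
Lemma gaugeD kd p lam u v : 0 <= p -> 0 <= u -> 0 <= v -> 0 < lam ->
  gauge kd p lam (u + v) <=
  2 `^ p * (gauge kd p (lam / 2) u + gauge kd p (lam / 2) v).
Proof.
move=> p0 u0 v0 l0.
have m0 : 0 <= Num.max u v by rewrite le_max u0.
apply: (@le_trans _ _ (gauge kd p lam (2 * Num.max u v))).
  apply: gauge_mono => //; first exact: addr_ge0.
  by rewrite mulr_natl mulr2n lerD // le_max lexx ?orbT.
by rewrite gaugeZ // ler_wpM2l ?powR_ge0 // gauge_max.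
Qed.

Lemma gauge_sum kd p lam (I : Type) (r : seq I) (P : pred I) (F : I -> R) u :
  gauge kd p lam (\big[Num.max/u]_(i <- r | P i) F i) <=
  gauge kd p lam u + \sum_(i <- r | P i) gauge kd p lam (F i).
Proof.
elim/big_rec2: _ => [|i y x Pi IH]; first by rewrite addr0.
apply: le_trans (gauge_max _ _ _ _ _) _.
by rewrite addrCA lerD2l.
Qed.

End Gauge.

Section Gadget.
Variable R : realType.

(** [hmass_le] makes a cell weigh about as much as its leaf, so that averaging over the cell is
    division by [lmass] up to a constant. [hub0] supplies a default point and the witness against
    doubling. *)
Record gadget := Gadget {
  hub : finType;
  leaf : finType;
  inc : leaf -> hub -> bool;
  hmass : hub -> R;
  lmass : leaf -> R;
  hub0 : hub;
  hmass_gt0 : forall h, 0 < hmass h;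
  lmass_gt0 : forall s, 0 < lmass s;
  hmass_le : forall s, \sum_(h | inc s h) hmass h <= lmass s }.

Implicit Types (g : gadget) (p lam C : R) (kd : kind).

Definition transfer g (f : hub g -> R) (s : leaf g) : R :=
  (\sum_(h | inc s h) hmass h * f h) / lmass s.

(* For p = 1 the restricted class is the full class, matching the convention
   that restricted weak type (1,1) means weak type (1,1). *)
Definition admissible kd p (T : Type) (f : T -> R) : Prop :=
  kd = Restr -> p = 1 \/ forall x, f x = 0 \/ f x = 1.

Definition transfer_bound kd p C g : Prop :=
  forall f : hub g -> R, (forall h, 0 <= f h) -> admissible kd p f ->
  forall lam, 0 < lam ->
  \sum_s lmass s * gauge kd p lam (transfer f s) <=
  C * \sum_h hmass h * f h `^ p.

Definition uniform_bound kd p (G : nat -> gadget) : Prop :=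
  exists C, forall k, transfer_bound kd p C (G k).

Definition realizes (G : nat -> gadget) (Q : kind -> R -> Prop) : Prop :=
  forall kd p, 1 <= p -> uniform_bound kd p G <-> Q kd p.

Lemma transfer_ge0 g (f : hub g -> R) s : (forall h, 0 <= f h) ->
  0 <= transfer f s.
Proof.
move=> f0; rewrite divr_ge0 ?(ltW (lmass_gt0 s)) // sumr_ge0 // => h _.
by rewrite mulr_ge0 // ltW // hmass_gt0.
Qed.

Lemma transfer_bound_weak p C g : 0 <= p ->
  transfer_bound Strong p C g -> transfer_bound Weak p C g.
Proof.
move=> p0 B f f0 _ lam l0; apply: le_trans (B f f0 _ lam l0) => //.
apply: ler_sum => s _; rewrite ler_wpM2l ?(ltW (lmass_gt0 s)) //=.
exact: (@gauge_le_powR _ Weak _ _ _ l0 p0 (transfer_ge0 s f0)).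
Qed.

Lemma transfer_bound_restr p C g :
  transfer_bound Weak p C g -> transfer_bound Restr p C g.
Proof. by move=> B f f0 _ lam l0; apply: B. Qed.

Lemma uniform_bound_weak p G : 0 <= p ->
  uniform_bound Strong p G -> uniform_bound Weak p G.
Proof. by move=> p0 [C B]; exists C => k; exact: transfer_bound_weak. Qed.

Lemma uniform_bound_restr p G :
  uniform_bound Weak p G -> uniform_bound Restr p G.
Proof. by move=> [C B]; exists C => k; exact: transfer_bound_restr. Qed.

(** Strong implies weak implies restricted: above [p0] the strongest kind suffices, below [p0]
    refuting the weakest does, and only the endpoint is examined kind by kind. *)
Lemma realizes_threshold (G : nat -> gadget) (p0 : R) (e : kind -> Prop) :
  (forall p, 1 <= p -> p0 < p -> uniform_bound Strong p G) ->
  (forall p, 1 <= p -> p < p0 -> ~ uniform_bound Restr p G) ->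
  (1 <= p0 -> forall kd, uniform_bound kd p0 G <-> e kd) ->
  realizes G (fun kd p => p0 < p \/ p = p0 /\ e kd).
Proof.
move=> up low mid kd p p1; have p_ge0 : 0 <= p by exact: le_trans p1.
case: (ltgtP p0 p) => [lt|gt|E].
- split=> [_|_]; first by left.
  have S := up _ p1 lt; have W := uniform_bound_weak p_ge0 S.
  by case: kd => //; exact: uniform_bound_restr.
- split=> [B|[lt|[E _]]].
  + exfalso; apply: (low _ p1 gt); case: kd B => // B.
      by apply: uniform_bound_restr; exact: uniform_bound_weak.
    exact: uniform_bound_restr.
  + by [].
  + by move: gt; rewrite E ltxx.
- subst p; rewrite (mid p1 kd); split; first by right.
  by case=> [|[]].
Qed.

End Gadget.

(** * Stars *)

Section Star.
Variable R : realType.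
Implicit Types (p x lam C : R) (n : nat -> nat -> nat).

(* In a star with one hub of mass 1 the leaves come in groups: [n k j] leaves
   of mass [2 ^ j] for each [j <= k]. *)
Definition star_leaf n k : finType := {j : 'I_k.+1 & 'I_(n k j)}.

Definition star_mass n k (s : star_leaf n k) : R := 2 ^+ (tag s).

Lemma star_mass_gt0 n k (s : star_leaf n k) : 0 < star_mass s.
Proof. exact: exprn_gt0. Qed.

Lemma star_mass_le n k (s : star_leaf n k) :
  \sum_(h : unit | true) (1 : R) <= star_mass s.
Proof.
by rewrite sumr_const card_unit mulr1n exprn_ege1 // ler1n.
Qed.

Definition star n k : gadget R :=
  @Gadget R unit (star_leaf n k) (fun _ _ => true) (fun=> 1)
    (@star_mass n k) tt (fun=> ltr01) (@star_mass_gt0 n k) (@star_mass_le n k).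

Lemma star_sum n k (F : nat -> R) :
  \sum_(s : star_leaf n k) F (tag s) = \sum_(j < k.+1) (n k j)%:R * F j.
Proof.
rewrite (eq_bigr (fun s : star_leaf n k => (fun j (_ : 'I_(n k j)) => F j) (tag s) (tagged s))) //.
rewrite -(@sig_big_dep _ _ _ _ _ xpredT (fun _ => xpredT) (fun (j : 'I_k.+1) (_ : 'I_(n k j)) => F j)) /=.
by apply: eq_bigr => j _; rewrite sumr_const card_ord mulr_natl.
Qed.

Lemma star_transfer n k (f : hub (star n k) -> R) (s : leaf (star n k)) :
  transfer f s = f tt / 2 ^+ (tag s).
Proof.
by rewrite /transfer /= (big_pred1 tt) ?mul1r //; case.
Qed.

Lemma star_hub_sum n k (F : unit -> R) :
  \sum_(h : hub (star n k)) hmass h * F h = F tt.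
Proof. by rewrite (big_pred1 tt) ?mul1r //; case. Qed.

Lemma star_sumE n k kd p lam (f : hub (star n k) -> R) :
  \sum_(s : leaf (star n k)) lmass s * gauge kd p lam (transfer f s) =
  \sum_(j < k.+1) (n k j)%:R * (2 ^+ j * gauge kd p lam (f tt / 2 ^+ j)).
Proof.
rewrite -(star_sum n k (fun j => 2 ^+ j * gauge kd p lam (f tt / 2 ^+ j))).
by apply: eq_bigr => s _; rewrite star_transfer.
Qed.

Lemma powR_inv x p : 0 <= x -> x^-1 `^ p = (x `^ p)^-1.
Proof.
by move=> x0; rewrite -powR_inv1 // powRAC powR_inv1 // powR_ge0.
Qed.

Lemma powR_pow2 (j : nat) p : (2 ^+ j : R) `^ p = (2 `^ p) ^+ j.
Proof.
rewrite -powR_mulrn // -powRrM mulrC powRrM powR_mulrn // powR_ge0.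
Qed.

Lemma pow2_split (j : nat) p : 2 ^+ j * ((2 ^+ j : R) `^ p)^-1 = (2 `^ (1 - p)) ^+ j.
Proof.
rewrite -powR_pow2 powRB; last by apply/implyP => _; rewrite gt_eqF // exprn_gt0.
by rewrite powRr1.
Qed.

(** With a single hub both sides are multiples of the p-th power of [f tt]; a leaf of mass 2^j
    contributes 2^j 2^(-jp), so the sum is the best constant. *)
Lemma star_strong n k p C : 1 <= p ->
  \sum_(j < k.+1) (n k j)%:R * (2 `^ (1 - p)) ^+ j <= C <->
  transfer_bound Strong p C (star n k).
Proof.
move=> p1; have p0 : 0 <= p by exact: le_trans p1.
have E (f : hub (star n k) -> R) lam : 0 <= f tt ->
    \sum_(s : leaf (star n k)) lmass s * gauge Strong p lam (transfer f s) =
    (\sum_(j < k.+1) (n k j)%:R * (2 `^ (1 - p)) ^+ j) * f tt `^ p.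
  move=> f0; rewrite star_sumE mulr_suml; apply: eq_bigr => j _ /=.
  rewrite -mulrA; congr (_ * _).
  rewrite powRM ?invr_ge0 ?exprn_ge0 // mulrCA mulrC powR_inv ?exprn_ge0 //.
  by rewrite pow2_split mulrC.
split=> [le f f0 _ lam l0|B].
  by rewrite star_hub_sum E // ler_wpM2r // powR_ge0.
have := B (fun=> 1) (fun=> ler01) (fun e => ltac:(discriminate e)) 1 ltr01.
by rewrite star_hub_sum E // powR1 !mulr1.
Qed.

(* Testing on the indicator of the hub at the level just below [2 ^- k]. *)
Lemma star_restr n k p C : 1 <= p ->
  transfer_bound Restr p C (star n k) ->
  (n k k)%:R * (2 `^ (1 - p)) ^+ k <= 2 `^ p * C.
Proof.
move=> p1 B; have p0 : 0 <= p by exact: le_trans p1.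
pose lam : R := 2^-1 / 2 ^+ k.
have l0 : 0 < lam by rewrite divr_gt0 ?invr_gt0 ?exprn_gt0.
have := B (fun=> 1) (fun=> ler01) (fun _ => or_intror (fun=> or_intror erefl)) _ l0.
rewrite star_hub_sum star_sumE powR1 mulr1 => le.
rewrite [leRHS]mulrC -ler_pdivrMr ?powR_gt0 //; apply: le_trans le.
rewrite (bigD1 ord_max) //= ler_wpDr //.
  apply: sumr_ge0 => j _; rewrite !mulr_ge0 ?exprn_ge0 ?powR_ge0 //.
have -> : lam < 1 / 2 ^+ k.
  by rewrite ltr_pM2r ?invr_gt0 ?exprn_gt0 // invf_lt1 // ltr1n.
have -> : lam `^ p = (2 `^ p)^-1 * ((2 ^+ k) `^ p)^-1.
  by rewrite powRM ?invr_ge0 ?exprn_ge0 // !powR_inv ?exprn_ge0.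
by rewrite mulr1 -mulrA ler_wpM2l // -pow2_split mulrCA mulrC mulrA mulrC.
Qed.

Lemma geo_sum_le x k : 0 <= x -> x < 1 ->
  \sum_(j < k.+1) x ^+ j <= (1 - x)^-1.
Proof.
move=> x0 x1; have d : 0 < 1 - x by rewrite subr_gt0.
rewrite -[leRHS]mul1r ler_pdivlMr // mulrC -opprB mulNr -subrX1 opprB.
by rewrite lerBlDr lerDl exprn_ge0.
Qed.

(** The last term of the geometric sum is its least, so k + 1 copies of it stay below the sum. *)
Lemma mul_expr_le x k : 0 <= x -> x < 1 -> k.+1%:R * x ^+ k <= (1 - x)^-1.
Proof.
move=> x0 x1; apply: le_trans (geo_sum_le k x0 x1).
rewrite mulr_natl -[X in _ *+ X]card_ord -sumr_const.
by apply: ler_sum => j _; rewrite ler_wiXn2l // 1?ltW // -ltnS.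
Qed.

Lemma linear_unbounded C : exists k : nat, C < k.+1%:R.
Proof.
exists (Num.Def.truncn `|C|); apply: le_lt_trans (ler_norm C) _.
by have /andP[] := truncn_itv (normr_ge0 C).
Qed.

(** Bernoulli's inequality: in the factorization of x^(k+1) - 1 by x - 1, each term of the cofactor
    is at least 1. *)
Lemma expr_unbounded x C : 1 < x -> exists k : nat, C < x ^+ k.
Proof.
move=> x1; have [k kC] := linear_unbounded (C / (x - 1)).
have d : 0 < x - 1 by rewrite subr_gt0.
exists k.+1; rewrite ltr_pdivrMr // in kC.
apply: lt_le_trans kC _; rewrite -[leRHS](subrK 1) subrX1 mulrC.
apply: (@le_trans _ _ ((x - 1) * \sum_(i < k.+1) x ^+ i)); last by rewrite lerDl.
have -> : k.+1%:R = \sum_(i < k.+1) (1 : R) by rewrite sumr_const card_ord.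
rewrite ler_wpM2l ?(ltW d) //.
by apply: ler_sum => i _; rewrite exprn_ege1 // ltW.
Qed.

(** The integer just above 2^((p0-1)j). That many leaves of mass 2^j contribute about 2^((p0-p)j) to
    the strong sum: decay above [p0], a constant at [p0], growth below. *)
Definition count (p0 : R) (j : nat) : nat := (Num.Def.truncn (((2 : R) `^ (p0 - 1)) ^+ j)).+1.

Lemma pow2_ge1 p : 0 <= p -> 1 <= (2 : R) `^ p.
Proof. by move=> p0; rewrite -[leLHS](powRr0 (2 : R)) ler_powR // ler1n. Qed.

Lemma count_ge p0 j : ((2 : R) `^ (p0 - 1)) ^+ j <= (count p0 j)%:R.
Proof. by apply/ltW/truncnS_gt. Qed.

Lemma count_le p0 j : 1 <= p0 -> (count p0 j)%:R <= 2 * ((2 : R) `^ (p0 - 1)) ^+ j.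
Proof.
move=> p01; have y1 : 1 <= ((2 : R) `^ (p0 - 1)) ^+ j.
  by rewrite exprn_ege1 // pow2_ge1 // subr_ge0.
rewrite /count -natr1 mulr_natl mulr2n lerD // truncn_le.
exact: le_trans y1.
Qed.

Lemma ratioE (p0 : R) p j :
  ((2 : R) `^ (p0 - 1)) ^+ j * (2 `^ (1 - p)) ^+ j = (2 `^ (p0 - p)) ^+ j.
Proof.
rewrite -exprMn -powRD; last by rewrite pnatr_eq0 implybT.
by congr ((_ `^ _) ^+ _); ring.
Qed.

Lemma count_ratio_le (p0 : R) p j : 1 <= p0 ->
  (count p0 j)%:R * (2 `^ (1 - p)) ^+ j <= 2 * ((2 : R) `^ (p0 - p)) ^+ j.
Proof.
move=> p01; rewrite -ratioE mulrA ler_wpM2r ?exprn_ge0 ?powR_ge0 //.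
exact: count_le.
Qed.

Lemma count_ratio_ge (p0 : R) p j :
  ((2 : R) `^ (p0 - p)) ^+ j <= (count p0 j)%:R * (2 `^ (1 - p)) ^+ j.
Proof.
rewrite -ratioE ler_wpM2r ?exprn_ge0 ?powR_ge0 //; exact: count_ge.
Qed.

Lemma ltr_pow2 p q : p < q -> (2 : R) `^ p < 2 `^ q.
Proof.
by move=> pq; rewrite /powR pnatr_eq0 /= ltr_expR ltr_pM2r // ln_gt0 // ltr1n.
Qed.

Lemma ratio_lt1 (p0 : R) p : p0 < p -> (2 : R) `^ (p0 - p) < 1.
Proof.
move=> lt; rewrite -opprB powRN invf_lt1 ?powR_gt0 //.
by rewrite -[ltLHS](powRr0 (2 : R)) ltr_pow2 // subr_gt0.
Qed.

(** Populating only the top level isolates one term of the series, where a full star sees its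
    sum. *)
Definition diag (c : nat -> nat) k j : nat := if j == k then c k else 0%N.

Lemma diag_sum (c : nat -> nat) k x :
  \sum_(j < k.+1) (diag c k j)%:R * x ^+ j = (c k)%:R * x ^+ k.
Proof.
rewrite (bigD1 ord_max) //= /diag eqxx big1 ?addr0 // => j jk.
by rewrite ifN ?mul0r // ; apply: contra jk => /eqP e; apply/eqP/val_inj.
Qed.

Lemma star_restr_fail n (p0 : R) p : 1 <= p -> p < p0 ->
  (forall k, (count p0 k <= n k k)%N) -> ~ uniform_bound Restr p (star n).
Proof.
move=> p1 lt le [C B].
have x1 : 1 < (2 : R) `^ (p0 - p) by rewrite -[ltLHS](powRr0 (2 : R)) ltr_pow2 // subr_gt0.
have [k] := expr_unbounded (2 `^ p * C) x1.
rewrite ltNge => /negP; apply; apply: le_trans (star_restr p1 (B k)).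
apply: le_trans (count_ratio_ge _ _ _) _.
by rewrite ler_wpM2r ?exprn_ge0 ?powR_ge0 // ler_nat.
Qed.

(** The extra factor k + 1 breaks even the restricted bound at [p0], while above [p0] the geometric
    decay absorbs it. *)
Lemma star_none p0 : 1 <= p0 ->
  realizes (star (diag (fun k => (k.+1 * count p0 k)%N)))
    (fun kd p => p0 < p \/ p = p0 /\ False).
Proof.
move=> p01; apply: realizes_threshold => [p p1 lt|p p1 lt|_ kd].
- exists (2 * (1 - 2 `^ (p0 - p))^-1) => k; apply/star_strong => //.
  rewrite diag_sum natrM -mulrA.
  apply: (@le_trans _ _ (k.+1%:R * (2 * (2 `^ (p0 - p)) ^+ k))).
    by rewrite ler_wpM2l // count_ratio_le.
  rewrite mulrCA ler_wpM2l // mul_expr_le ?powR_ge0 //; exact: ratio_lt1.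
- apply: (star_restr_fail p1 lt) => k.
  by rewrite /diag eqxx leq_pmull.
- split=> // B.
  have [C {}B] : uniform_bound Restr p0 (star (diag (fun k => (k.+1 * count p0 k)%N))).
    case: kd B => // B; apply: uniform_bound_restr => //.
    by apply: uniform_bound_weak => //; exact: le_trans p01.
  have [k] := linear_unbounded (2 `^ p0 * C).
  rewrite ltNge => /negP; apply; apply: le_trans (star_restr p01 (B k)).
  rewrite /diag eqxx natrM -mulrA -[leLHS]mulr1 ler_wpM2l //.
  by apply: le_trans (count_ratio_ge _ _ _); rewrite subrr powRr0 expr1n.
Qed.

(** A single group contributes at most 2 to the strong sum from [p0] on. *)
Lemma star_all p0 : 1 <= p0 ->
  realizes (star (diag (count p0))) (fun kd p => p0 < p \/ p = p0 /\ True).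
Proof.
move=> p01.
have up p : 1 <= p -> p0 <= p -> uniform_bound Strong p (star (diag (count p0))).
  move=> p1 le; exists 2 => k; apply/star_strong => //.
  rewrite diag_sum; apply: le_trans (count_ratio_le _ _ _) _ => //.
  rewrite -[leRHS]mulr1 ler_wpM2l // exprn_ile1 ?powR_ge0 //.
  by rewrite -[leRHS](powRr0 (2 : R)) ler_powR ?ler1n // subr_le0.
apply: realizes_threshold => [p p1 lt|p p1 lt|_ kd].
- by apply: up => //; exact: ltW.
- by apply: (star_restr_fail p1 lt) => k; rewrite /diag eqxx.
- split=> // _; have S := up p0 p01 (lexx _).
  have W := uniform_bound_weak (le_trans ler01 p01) S.
  by case: kd => //; exact: uniform_bound_restr.
Qed.

(** For every finite p, 2^(k^2) leaves outgrow 2^((p-1)k). *)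
Lemma star_empty : realizes (star (diag (fun k => (2 ^ (k * k))%N))) (fun _ _ => False).
Proof.
move=> kd p p1; split=> // B.
have [C {}B] : uniform_bound Restr p (star (diag (fun k => (2 ^ (k * k))%N))).
  case: kd B => // B; apply: uniform_bound_restr => //.
  by apply: uniform_bound_weak => //; exact: le_trans p1.
have [k1 h1] := linear_unbounded p.
have [k2] := @expr_unbounded 2 (2 `^ p * C) (ltac:(by rewrite ltr1n)).
(* The first entry gives p <= k, so that the base 2^(k+1-p) is at least 2; the second makes 2^k
   exceed the constant. *)
pose k := maxn k1.+1 k2.
rewrite ltNge => /negP; apply; apply: le_trans (star_restr p1 (B k)).
rewrite /diag eqxx natrX exprM -exprMn.
apply: (@le_trans _ _ (2 ^+ k)); first by rewrite ler_weXn2l ?ler1n // leq_maxr.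
rewrite lerXn2r ?nnegrE ?mulr_ge0 ?exprn_ge0 ?powR_ge0 //.
rewrite -powR_mulrn // -powRD; last by rewrite pnatr_eq0 implybT.
rewrite -[leLHS]powRr1 // ler_powR ?ler1n // addrCA lerDl subr_ge0.
by apply: le_trans (ltW h1) _; rewrite ler_nat leq_maxl.
Qed.

(** The terms at least double at each step, so the sum is within a factor 2 of its largest term,
    which is at most x^p. *)
Lemma geo_sum_level p x k : 1 <= p -> 0 <= x ->
  \sum_(j < k.+1) (if (2 ^+ j : R) < x then (2 `^ p) ^+ j else 0) <= 2 * x `^ p.
Proof.
move=> p1 x0; have y2 : 2 <= (2 : R) `^ p.
  by rewrite -[leLHS]powRr1 // ler_powR // ler1n.
have S m : \sum_(j < m.+1) (2 `^ p) ^+ j <= 2 * (2 `^ p : R) ^+ m.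
  elim: m => [|m IH]; first by rewrite big_ord_recl big_ord0 expr0; lra.
  rewrite big_ord_recr /= exprS; apply: le_trans (lerD IH (lexx _)) _.
  have : 0 <= (2 `^ p : R) ^+ m by rewrite exprn_ge0 // powR_ge0.
  by move: ((2 `^ p : R) ^+ m) (2 `^ p : R) y2 => a b; nra.
elim: k => [|k IH]; rewrite big_ord_recr /=.
  rewrite big_ord0 add0r !expr0; case: ltP => [x1|_]; last by rewrite mulr_ge0 ?powR_ge0.
  have : 1 `^ p <= x `^ p by apply: powR_mono => //; [exact: le_trans p1|exact: ltW].
  rewrite powR1.
  by lra.
case: ltP => [lt|_]; last by rewrite addr0.
(* The top level already lies below [x], so the unconditional sum, at most twice its last term, will
   do. *)
apply: (@le_trans _ _ (\sum_(j < k.+2) (2 `^ p) ^+ j)).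
  rewrite [leRHS]big_ord_recr /= lerD2r; apply: ler_sum => j _.
  by case: ifP => _ //; rewrite exprn_ge0 // powR_ge0.
apply: le_trans (S _) _; rewrite ler_wpM2l // -powR_pow2 powR_mono ?exprn_ge0 //.
  exact: le_trans p1.
exact: ltW.
Qed.

(** At [p0] each of the k + 1 levels contributes at least 1 to the strong sum. At a fixed height
    [lam] only the levels with 2^j below f/lam count, and the mass of their groups is bounded by a
    geometric progression. *)
Lemma star_weak p0 : 1 <= p0 ->
  realizes (star (fun _ => count p0)) (fun kd p => p0 < p \/ p = p0 /\ kd <> Strong).
Proof.
move=> p01; have p00 : 0 <= p0 by exact: le_trans p01.
apply: realizes_threshold => [p p1 lt|p p1 lt|_].
- exists (2 * (1 - 2 `^ (p0 - p))^-1) => k; apply/star_strong => //.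
  apply: (@le_trans _ _ (\sum_(j < k.+1) 2 * (2 `^ (p0 - p)) ^+ j)).
    by apply: ler_sum => j _; rewrite count_ratio_le.
  by rewrite -mulr_sumr ler_wpM2l // geo_sum_le ?powR_ge0 //; exact: ratio_lt1.
- exact: (star_restr_fail p1 lt).
have W : uniform_bound Weak p0 (star (fun _ => count p0)).
  (* One factor 2 comes from the rounding in [count], the other from [geo_sum_level]. *)
  exists 4 => k f f0 _ lam l0; rewrite star_hub_sum star_sumE.
  pose x := f tt / lam.
  have x0 : 0 <= x by rewrite divr_ge0 // ltW.
  have fE : f tt `^ p0 = lam `^ p0 * x `^ p0.
    by rewrite -powRM // 1?ltW // /x mulrC divfK // gt_eqF.
  have := geo_sum_level k p01 x0.
  move=> /(ler_wpM2l (powR_ge0 lam p0)) /(ler_wpM2l (ler0n R 2)) le.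
  rewrite fE; apply: le_trans (le_trans le _); last first.
    by rewrite le_eqVlt; apply/orP; left; apply/eqP; ring.
  rewrite !mulr_sumr; apply: ler_sum => j _ /=.
  have j0 : (0 : R) < 2 ^+ j by rewrite exprn_gt0.
  rewrite ltr_pdivlMr // /x ltr_pdivlMr // (mulrC (2 ^+ j) lam).
  case: ltP => _; last by rewrite !mulr0.
  have le2 : (count p0 j)%:R * 2 ^+ j <= 2 * (2 `^ p0 : R) ^+ j.
    apply: le_trans (ler_wpM2r (ltW j0) (count_le _ p01)) _.
    by rewrite -mulrA -exprMn (mulrC _ 2) mulr_powRB1 // (lt_le_trans ltr01).
  have -> : (count p0 j)%:R * (2 ^+ j * (lam `^ p0 * 1)) =
            lam `^ p0 * ((count p0 j)%:R * 2 ^+ j) by ring.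
  by rewrite [leRHS]mulrCA ler_wpM2l ?powR_ge0.
case=> //.
- split; last by case.
  case=> C B; exfalso; have [k] := linear_unbounded C.
  rewrite ltNge => /negP; apply.
  have /(star_strong _ _ _ p01) := B k; apply: le_trans.
  rewrite -[X in X%:R]card_ord -sumr_const; apply: ler_sum => j _.
  by apply: le_trans (count_ratio_ge _ _ _); rewrite subrr powRr0 expr1n.
- by split=> // _; exact: uniform_bound_restr.
Qed.

End Star.

(** * Trees *)

Section Tree.
Variable R : realType.
Implicit Types (p x lam C : R) (K : nat).

Section Fixed.
(* [c ^ (p0 - 1) = 1 / 2]: passing to the next level doubles the number of
   leaves below a hub and multiplies its mass by [c]. *)
Variable p0 : R.
Hypothesis p0_gt1 : 1 < p0.
Let c : R := 2 `^ (- (p0 - 1)^-1).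

Lemma tree_ratio_gt0 : 0 < c. Proof. exact: powR_gt0. Qed.

Lemma tree_ratio_lt1 : c < 1.
Proof.
by rewrite -[ltRHS](powRr0 (2 : R)) ltr_pow2 // oppr_lt0 invr_gt0 subr_gt0.
Qed.

Let c0 := tree_ratio_gt0.
Let c1 := tree_ratio_lt1.

Lemma tree_ratioE x : c `^ x = 2 `^ (- x / (p0 - 1)).
Proof. by rewrite -powRrM !mulNr mulrC. Qed.

Lemma tree_ratio_powR : 2 * c `^ (p0 - 1) = 1.
Proof.
rewrite tree_ratioE mulNr divff; last by rewrite gt_eqF // subr_gt0.
by rewrite powRN powRr1 // divff // pnatr_eq0.
Qed.

(** The tag is the height k above the leaves: hub q at height k lies above the leaves i whose
    quotient by 2^k is q, and height K has a single hub. *)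
Definition tree_hub K : finType := {k : 'I_K.+1 & 'I_(2 ^ (K - k))}.
Definition tree_leaf K : finType := 'I_(2 ^ K).

Definition tree_inc K (i : tree_leaf K) (h : tree_hub K) : bool :=
  (i %/ 2 ^ (tag h) == tagged h)%N.

Lemma above_proof K (i : tree_leaf K) (k : 'I_K.+1) :
  (i %/ 2 ^ k < 2 ^ (K - k))%N.
Proof.
rewrite ltn_divLR ?expn_gt0 // -expnD subnK; first exact: ltn_ord.
by rewrite -ltnS.
Qed.

Definition above K (i : tree_leaf K) (k : 'I_K.+1) : tree_hub K :=
  Tagged (fun k : 'I_K.+1 => 'I_(2 ^ (K - k))) (Ordinal (above_proof i k)).

Lemma tree_hub_sum K (F : tree_hub K -> R) :
  \sum_h F h = \sum_(k < K.+1) \sum_(q < 2 ^ (K - k))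
    F (Tagged (fun k : 'I_K.+1 => 'I_(2 ^ (K - k))) q).
Proof.
rewrite (@sig_big_dep _ _ _ _ _ xpredT (fun _ => xpredT)
  (fun k q => F (Tagged (fun k : 'I_K.+1 => 'I_(2 ^ (K - k))) q))) /=.
by apply: eq_bigr => -[k q].
Qed.

Lemma tree_above_sum K (i : tree_leaf K) (F : tree_hub K -> R) :
  \sum_(h | tree_inc i h) F h = \sum_(k < K.+1) F (above i k).
Proof.
rewrite big_mkcond tree_hub_sum; apply: eq_bigr => k _.
rewrite (bigD1 (Ordinal (above_proof i k))) //= /tree_inc /= eqxx.
rewrite big1 ?addr0 // => q qi; rewrite ifN //.
by apply: contra qi => /eqP e; apply/eqP/val_inj.
Qed.

(** Leaves below one hub share their quotient by 2^k, so the remainder determines them. *)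
Lemma tree_below_card K (h : tree_hub K) :
  (#|[pred i | tree_inc i h]| <= 2 ^ tag h)%N.
Proof.
have pr (i : tree_leaf K) : (i %% 2 ^ tag h < 2 ^ tag h)%N by rewrite ltn_mod expn_gt0.
rewrite -[leqRHS]card_ord -(@card_in_image _ _ (fun i => Ordinal (pr i))).
  exact: max_card.
move=> i j; rewrite !inE /tree_inc => /eqP iE /eqP jE [e].
apply/val_inj => /=; rewrite (divn_eq i (2 ^ tag h)) e.
by rewrite [LHS]/= iE -jE -divn_eq.
Qed.

(** Double counting: a hub at height k is charged once for each of its at most 2^k leaves. *)
Lemma tree_exchange K (F : tree_hub K -> R) : (forall h, 0 <= F h) ->
  \sum_(i : tree_leaf K) \sum_(k < K.+1) F (above i k) <=
  \sum_(h : tree_hub K) 2 ^+ tag h * F h.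
Proof.
move=> F0; under eq_bigr => i _ do rewrite -tree_above_sum.
rewrite (exchange_big_dep xpredT) //=; apply: ler_sum => h _.
rewrite sumr_const -[leLHS]mulr_natl ler_wpM2r // -natrX ler_nat.
exact: tree_below_card.
Qed.

Lemma tree_hmass_gt0 K (h : tree_hub K) : 0 < c ^+ tag h.
Proof. exact: exprn_gt0. Qed.

(** The mass of every leaf: the full geometric series bounds the hubs above it, whatever [K] is. *)
Let D : R := (1 - c)^-1.

Lemma tree_D_gt0 : 0 < D. Proof. by rewrite invr_gt0 subr_gt0. Qed.
Let D0 := tree_D_gt0.

Lemma tree_DV_ge0 : 0 <= D^-1. Proof. by rewrite invr_ge0 ltW. Qed.
Let DV0 := tree_DV_ge0.

Lemma tree_half_lt : D^-1 / 2 < D^-1.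
Proof.
have : 0 < D^-1 by rewrite invr_gt0.
by move: (D^-1) => d; lra.
Qed.
Let Dh := tree_half_lt.

Lemma tree_hmass_le K (i : tree_leaf K) : \sum_(h | tree_inc i h) c ^+ tag h <= D.
Proof.
rewrite (@tree_above_sum K i (fun h => c ^+ tag h)) /=.
exact: (geo_sum_le K (ltW c0) c1).
Qed.

Definition tree K : gadget R :=
  @Gadget R (tree_hub K) (tree_leaf K) (@tree_inc K) (fun h => c ^+ tag h)
    (fun=> D) (above (Ordinal (expn_gt0 2 K)) ord0) (@tree_hmass_gt0 K) (fun=> D0)
    (@tree_hmass_le K).

Lemma tree_transfer K (f : hub (tree K) -> R) (i : leaf (tree K)) :
  transfer f i = (\sum_(k < K.+1) c ^+ k * f (above i k)) / D.
Proof. by rewrite /transfer /= (tree_above_sum i (fun h => c ^+ tag h * f h)). Qed.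

(** The weights sum to at most (1 - r)^-1, which leaves the maximum of x, and the p-th power of a
    maximum is below the sum of the p-th powers. *)
Lemma weighted_sum_powR (r p : R) n (x : 'I_n.+1 -> R) : 0 < p -> 0 <= r -> r < 1 ->
  (forall k, 0 <= x k) ->
  (\sum_(k < n.+1) r ^+ k * x k) `^ p <= ((1 - r)^-1) `^ p * \sum_(k < n.+1) x k `^ p.
Proof.
move=> p_gt0 r0 r1 x0; pose M : R := \big[Num.max/0]_(k < n.+1) x k.
have M0 : 0 <= M.
  by rewrite /M; elim/big_ind: _ => // a b a0 b0; rewrite le_max a0.
have xM k : x k <= M by rewrite /M (bigmax_sup k).
have E0 : 0 <= (1 - r)^-1 by rewrite invr_ge0 subr_ge0 ltW.
have le : \sum_(k < n.+1) r ^+ k * x k <= (1 - r)^-1 * M.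
  apply: (@le_trans _ _ (\sum_(k < n.+1) r ^+ k * M)).
    by apply: ler_sum => k _; rewrite ler_wpM2l // exprn_ge0.
  by rewrite -mulr_suml ler_wpM2r // geo_sum_le.
have S0 : 0 <= \sum_(k < n.+1) r ^+ k * x k.
  by apply: sumr_ge0 => k _; rewrite mulr_ge0 // exprn_ge0.
apply: le_trans (powR_mono (ltW p_gt0) S0 le) _.
rewrite powRM // ler_wpM2l ?powR_ge0 //.
apply: le_trans (@gauge_sum R Strong p 1 _ _ _ _ _) _ => /=.
by rewrite powR0 ?add0r // gt_eqF.
Qed.

Lemma tree_strong p : p0 < p -> uniform_bound Strong p tree.
Proof.
move=> lt; have p_gt1 : 1 < p := lt_trans p0_gt1 lt.
have p_gt0 : 0 < p := lt_trans ltr01 p_gt1.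
(* Split c as r times c/r with r^p = 2 c^(p-1), below 1 since p > p0. The weights r^k are summed by
   [weighted_sum_powR], and 2 (c/r)^p = c turns the 2^k leaves below a hub back into its mass. *)
pose r := (2 * c `^ (p - 1)) `^ p^-1.
have b0 : 0 < 2 * c `^ (p - 1) by rewrite mulr_gt0 // powR_gt0.
have b1 : 2 * c `^ (p - 1) < 1.
  rewrite -[ltRHS]tree_ratio_powR ltr_pM2l // !tree_ratioE ltr_pow2 //.
  by rewrite ltr_pM2r ?invr_gt0 ?subr_gt0 // ltrN2 ltrD2r.
have r0 : 0 < r by exact: powR_gt0.
have r1 : r < 1.
  apply: (@lt_le_trans _ _ (1 `^ p^-1)); last by rewrite powR1.
  apply: gt0_ltr_powR; rewrite ?nnegrE ?invr_gt0 //.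
  exact: ltW.
have rp : r `^ p = 2 * c `^ (p - 1).
  by rewrite -powRrM mulVf ?gt_eqF // powRr1 // ltW.
have key : 2 * (c / r) `^ p = c.
  rewrite powRM ?invr_ge0 ?ltW // powR_inv ?ltW // rp -(mulr_powRB1 (ltW c0) p_gt0).
  move: (c `^ (p - 1)) (powR_gt0 (p - 1) c0) => y y0.
  by field; rewrite gt_eqF.
exists (D * (((1 - r)^-1) `^ p * (D^-1) `^ p)) => K f f0 _ lam _ /=.
apply: (@le_trans _ _ (\sum_(i : tree_leaf K) D * ((((1 - r)^-1) `^ p * (D^-1) `^ p) *
   \sum_(k < K.+1) ((c / r) `^ p) ^+ k * f (above i k) `^ p))).
  apply: ler_sum => i _; rewrite ler_wpM2l ?(ltW D0) // tree_transfer.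
  have E : \sum_(k < K.+1) c ^+ k * f (above i k) =
      \sum_(k < K.+1) r ^+ k * ((c / r) ^+ k * f (above i k)).
    apply: eq_bigr => k _; rewrite mulrA -exprMn; congr (_ ^+ _ * _).
    by rewrite mulrC divfK // gt_eqF.
  have cr0 : 0 <= c / r by rewrite divr_ge0 // ltW.
  rewrite E powRM ?DV0 //; last first.
    by apply: sumr_ge0 => k _; rewrite !mulr_ge0 ?exprn_ge0 // ltW.
  rewrite mulrAC ler_wpM2r ?powR_ge0 //.
  apply: le_trans (weighted_sum_powR p_gt0 (ltW r0) r1 _) _.
    by move=> k; rewrite mulr_ge0 // exprn_ge0.
  rewrite ler_wpM2l ?powR_ge0 //; apply: ler_sum => k _.
  rewrite powRM ?exprn_ge0 // -(powR_mulrn _ cr0) -powRrM (mulrC _ p) powRrM.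
  by rewrite powR_mulrn ?powR_ge0.
rewrite -!mulr_sumr -!mulrA !ler_wpM2l ?powR_ge0 ?(ltW D0) //.
apply: le_trans (tree_exchange (F := fun h => ((c / r) `^ p) ^+ tag h * f h `^ p) _) _.
  by move=> h; rewrite mulr_ge0 ?exprn_ge0 ?powR_ge0.
by apply: ler_sum => h _; rewrite mulrA -exprMn key.
Qed.

(** For 0-1 values the series is comparable to its first nonzero term: while the leading value is 0
    a factor c^p comes out of both sides, and once it is 1 the left side is at most D^p. *)
Lemma indicator_sum_powR p n (f : nat -> R) : 0 < p ->
  (forall k, f k = 0 \/ f k = 1) ->
  (\sum_(k < n) c ^+ k * f k) `^ p <= D `^ p * \sum_(k < n) (c `^ p) ^+ k * f k.
Proof.
move=> p_gt0; elim: n f => [|n IH] f f01.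
  by rewrite !big_ord0 powR0 ?mulr0 // gt_eqF.
have f0 k : 0 <= f k by case: (f01 k) => ->.
have f1 k : f k <= 1 by case: (f01 k) => ->.
have S0 : 0 <= \sum_(k < n.+1) c ^+ k * f k.
  by apply: sumr_ge0 => k _; rewrite mulr_ge0 // exprn_ge0 // ltW.
case: (f01 0%N) => E.
  rewrite !big_ord_recl E !mulr0 !add0r.
  have -> : \sum_(i < n) c ^+ bump 0 i * f (bump 0 i) = c * \sum_(i < n) c ^+ i * f i.+1.
    by rewrite mulr_sumr; apply: eq_bigr => i _; rewrite /bump add1n exprS mulrA.
  have -> : \sum_(i < n) c `^ p ^+ bump 0 i * f (bump 0 i) =
      c `^ p * \sum_(i < n) c `^ p ^+ i * f i.+1.
    by rewrite mulr_sumr; apply: eq_bigr => i _; rewrite /bump add1n exprS mulrA.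
  rewrite powRM ?(ltW c0) //; last first.
    by apply: sumr_ge0 => k _; rewrite mulr_ge0 // exprn_ge0 // ltW.
  rewrite [leRHS]mulrCA ler_wpM2l ?powR_ge0 //.
  by apply: (IH (fun k => f k.+1)) => k; exact: f01.
apply: (@le_trans _ _ (D `^ p)).
  apply: powR_mono; rewrite ?(ltW p_gt0) //.
  apply: le_trans (geo_sum_le n (ltW c0) c1); apply: ler_sum => k _.
  by rewrite -[leRHS]mulr1 ler_wpM2l // exprn_ge0 // ltW.
rewrite -[leLHS]mulr1 ler_wpM2l ?powR_ge0 // big_ord_recl E expr0 mulr1 lerDl.
by apply: sumr_ge0 => k _; rewrite mulr_ge0 // exprn_ge0 // powR_ge0.
Qed.

Lemma tree_restr : uniform_bound Restr p0 tree.
Proof.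
have p_gt0 : 0 < p0 := lt_trans ltr01 p0_gt1.
exists D => K f f0 adm lam l0.
have f01 h : f h = 0 \/ f h = 1.
  by case: (adm erefl) => [e|]; [move: p0_gt1; rewrite e ltxx|].
apply: (@le_trans _ _ (\sum_(i : tree_leaf K) D *
   \sum_(k < K.+1) (c `^ p0) ^+ k * f (above i k))).
  apply: ler_sum => i _; rewrite ler_wpM2l ?(ltW D0) //.
  (* On indicators even the strong inequality holds, and it dominates the gauge. *)
  apply: le_trans (gauge_le_powR Restr l0 (ltW p_gt0) (transfer_ge0 i f0)) _.
  have S0 : 0 <= \sum_(k < K.+1) c ^+ k * f (above i k).
    by apply: sumr_ge0 => k _; rewrite mulr_ge0 // exprn_ge0 // ltW.
  rewrite tree_transfer powRM ?DV0 //.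
  rewrite (powR_inv p0 (ltW D0)).
  rewrite ler_pdivrMr ?powR_gt0 // mulrC.
  have := @indicator_sum_powR p0 K.+1 (fun k => f (above i (inord k))) p_gt0 (fun k => f01 _).
  under eq_bigr do rewrite inord_val.
  by under [X in _ <= _ * X -> _]eq_bigr do rewrite inord_val.
rewrite -mulr_sumr ler_wpM2l ?(ltW D0) //.
apply: le_trans (tree_exchange (F := fun h => (c `^ p0) ^+ tag h * f h) _) _.
  by move=> h; rewrite mulr_ge0 ?exprn_ge0 ?powR_ge0.
apply: ler_sum => h _; rewrite mulrA -exprMn.
(* The choice of c: at the endpoint the 2^k leaves below a hub, weighted by c^(k p0), give exactly
   its mass. *)
have -> : 2 * c `^ p0 = c.
  by rewrite -(mulr_powRB1 (ltW c0) p_gt0) mulrCA tree_ratio_powR mulr1.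
rewrite ler_wpM2l ?exprn_ge0 ?(ltW c0) //.
by case: (f01 h) => ->; rewrite ?powR1 ?powR_ge0.
Qed.

Lemma tree_restr_fail p : 1 <= p -> p < p0 -> ~ uniform_bound Restr p tree.
Proof.
move=> p1 lt [C B]; have p_gt0 : 0 < p := lt_le_trans ltr01 p1.
have b1 : 1 < 2 * c `^ (p - 1).
  rewrite -[ltLHS]tree_ratio_powR ltr_pM2l // !tree_ratioE ltr_pow2 //.
  by rewrite ltr_pM2r ?invr_gt0 ?subr_gt0 // ltrN2 ltrD2r.
pose w : R := D * (D^-1 / 2) `^ p.
have w0 : 0 < w by rewrite mulr_gt0 // powR_gt0 // divr_gt0 // invr_gt0.
have [K] := expr_unbounded (C / w) b1.
rewrite ltNge => /negP; apply; rewrite ler_pdivlMr //.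
(* The top hub reaches every leaf with the same value c^K/D, and [lam] is half of it; the quotient
   of the two sides grows like (2 c^(p-1))^K. *)
pose f (h : hub (tree K)) : R := (tag h == ord_max)%:R.
have f01 h : f h = 0 \/ f h = 1 by rewrite /f; case: eqP; [right|left].
have f0 h : 0 <= f h by case: (f01 h) => ->.
pose lam : R := c ^+ K * (D^-1 / 2).
have l0 : 0 < lam by rewrite mulr_gt0 ?exprn_gt0 // divr_gt0 // invr_gt0.
have := B K f f0 (fun _ => or_intror f01) lam l0.
have T i : transfer f i = c ^+ K * D^-1.
  rewrite tree_transfer (bigD1 ord_max) //= /f /= eqxx mulr1 big1 ?addr0 // => k kK.
  by rewrite (negbTE kK) mulr0.
under eq_bigr => i _.
  rewrite T /= (_ : lam < _); last first.
    by rewrite ltr_pM2l ?exprn_gt0 // Dh.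
  over.
rewrite sumr_const card_ord mulr1 => le.
have R1 : \sum_(h : tree_hub K) c ^+ tag h * f h `^ p = c ^+ K.
  rewrite tree_hub_sum (bigD1 ord_max) //= [X in _ + X]big1 ?addr0.
    rewrite /f /= eqxx powR1 mulr1 sumr_const card_ord subnn expn0 mulr1n //.
  move=> k kK; apply: big1 => q _; rewrite /f /= (negbTE kK) powR0 ?mulr0 //.
  by rewrite gt_eqF.
rewrite R1 in le.
have cK : 0 < c ^+ K by rewrite exprn_gt0.
rewrite -(ler_pM2r cK); apply: le_trans le.
rewrite /lam powRM ?exprn_ge0 ?(ltW c0) ?divr_ge0 ?DV0 //.
rewrite -[leRHS]mulr_natl natrX exprMn.
have -> : (c ^+ K) `^ p = (c `^ (p - 1)) ^+ K * c ^+ K.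
  rewrite -exprMn (mulrC _ c) mulr_powRB1 ?(ltW c0) //.
  by rewrite -powR_mulrn ?(ltW c0) // -powRrM mulrC powRrM powR_mulrn ?powR_ge0.
by rewrite /w le_eqVlt; apply/orP; left; apply/eqP; ring.
Qed.

Lemma tree_weak_fail : ~ uniform_bound Weak p0 tree.
Proof.
move=> [C B]; have p_gt0 : 0 < p0 := lt_trans ltr01 p0_gt1.
have q0 : 0 < p0 - 1 by rewrite subr_gt0.
pose w : R := D * (D^-1 / 2) `^ p0.
have w0 : 0 < w by rewrite mulr_gt0 // powR_gt0 // divr_gt0 // invr_gt0.
have [K] := linear_unbounded (`|C / w| `^ (p0 - 1)^-1).
rewrite ltNge => /negP; apply.
have N0 : (0 : R) < K.+1%:R by rewrite ltr0n.
suff le : K.+1%:R `^ (p0 - 1) <= `|C / w|.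
  have := powR_mono (p := (p0 - 1)^-1) (ltac:(by rewrite invr_ge0 ltW)) (powR_ge0 _ _) le.
  by rewrite -powRrM mulfV ?gt_eqF // powRr1 // ltW.
apply: le_trans (ler_norm _); rewrite ler_pdivlMr //.
(* All K + 1 heights now contribute equally to each leaf: the left side is about 2^K (K+1)^p0, the
   right side C 2^K (K+1). *)
pose f (h : hub (tree K)) : R := (c ^+ tag h)^-1.
have f0 h : 0 <= f h by rewrite invr_ge0 exprn_ge0 // ltW.
pose lam : R := K.+1%:R * (D^-1 / 2).
have l0 : 0 < lam by rewrite mulr_gt0 // divr_gt0 // invr_gt0.

have := B K f f0 (ltac:(discriminate)) lam l0.
have T i : transfer f i = K.+1%:R * D^-1.
  rewrite tree_transfer; congr (_ / _); rewrite -[X in X%:R]card_ord -sumr_const.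
  by apply: eq_bigr => k _; rewrite /f /= divff // gt_eqF // exprn_gt0.
under eq_bigr => i _.
  rewrite T /= (_ : lam < _); last first.
    by rewrite ltr_pM2l // Dh.
  over.
rewrite sumr_const card_ord mulr1 => le.
have R1 : \sum_(h : tree_hub K) c ^+ tag h * f h `^ p0 = K.+1%:R * 2 ^+ K.
  rewrite tree_hub_sum -[X in X%:R * _]card_ord mulr_natl -sumr_const.
  apply: eq_bigr => k _; rewrite /f /= sumr_const card_ord.
  have -> : c ^+ k * (c ^+ k)^-1 `^ p0 = 2 ^+ k.
    rewrite powR_inv ?exprn_ge0 ?(ltW c0) //.
    have -> : (c ^+ k) `^ p0 = (c `^ (p0 - 1)) ^+ k * c ^+ k.
      rewrite -exprMn (mulrC _ c) mulr_powRB1 ?(ltW c0) //.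
      by rewrite -powR_mulrn ?(ltW c0) // -powRrM mulrC powRrM powR_mulrn ?powR_ge0.
    rewrite invfM mulrCA divff ?mulr1; last by rewrite gt_eqF // exprn_gt0.
    rewrite -exprVn; congr (_ ^+ _); apply: (mulfI (x := c `^ (p0 - 1))).
      by rewrite gt_eqF // powR_gt0.
    by rewrite mulfV 1?mulrC ?tree_ratio_powR // gt_eqF // powR_gt0.
  by rewrite -[LHS]mulr_natl natrX -exprD subnK // -ltnS.
rewrite R1 in le.
have K2 : (0 : R) < K.+1%:R * 2 ^+ K by rewrite mulr_gt0 // exprn_gt0.
rewrite -(ler_pM2r K2); apply: le_trans le.
rewrite /lam powRM ?divr_ge0 ?DV0 //.
rewrite -[leRHS]mulr_natl natrX -(mulr_powRB1 (ltW N0) p_gt0).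
by rewrite /w le_eqVlt; apply/orP; left; apply/eqP; ring.
Qed.

Lemma tree_realizes :
  realizes tree (fun kd p => p0 < p \/ p = p0 /\ kd = Restr).
Proof.
have p_ge0 : 0 <= p0 by exact/ltW/(lt_trans ltr01).
apply: realizes_threshold => [p p1 lt|p p1 lt|_ kd].
- exact: tree_strong.
- exact: tree_restr_fail.
- have nW := tree_weak_fail.
  case: kd; split=> // B; last exact: tree_restr.
  by exfalso; apply: nW; exact: uniform_bound_weak.
Qed.

End Fixed.
End Tree.

(** * Gadgets for a prescribed triple of exponent sets *)

Section Family.
Variable R : realType.
Implicit Types (P Ps Pw Pr : set (\bar R)).

Definition by_kind Ps Pw Pr (kd : kind) : set (\bar R) :=
  match kd with Strong => Ps | Weak => Pw | Restr => Pr end.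

Lemma realizes_ext (G : nat -> gadget R) (Q Q' : kind -> R -> Prop) :
  (forall kd p, 1 <= p -> Q kd p <-> Q' kd p) -> realizes G Q -> realizes G Q'.
Proof.
by move=> QQ' r kd p p1; split=> [/(r _ _ p1)/(QQ' _ _ p1)|/(QQ' _ _ p1)/(r _ _ p1)].
Qed.

Lemma exp_set_form_pinfty P : exp_set_form P -> P +oo%E.
Proof. by case=> [->//|[p0 _ [->|->]]]; rewrite /= ?leey ?ltry. Qed.

Lemma gadget_family Ps Pw Pr : exp_set_form Ps ->
  Ps `<=` Pw -> Pw `<=` Pr -> Pr `<=` closure Ps ->
  (Pr = full_range -> Pw = full_range) ->
  exists G : nat -> gadget R,
    realizes G (fun kd p => by_kind Ps Pw Pr kd p%:E).
Proof.
move=> Fs sw wr rc full; have [Es|[p0 p01 Es]] := Fs.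
  have fin p : ~ Pr p%:E.
    move=> /rc; rewrite Es => cl.
    (* As a closed half-line this set is its own closure, which rules out finite exponents. *)
    have e : [set +oo%E] = [set q : \bar R | (+oo <= q)%E].
      by apply/seteqP; split=> q /=; rewrite leye_eq => /eqP.
    move: cl; rewrite e -(proj1 (closure_id _) (@closed_ereal_le_ereal R +oo%E)) /=.
    by rewrite leye_eq.
  exists (@star R (diag (fun k => (2 ^ (k * k))%N))).
  apply: realizes_ext (@star_empty R) => kd p _; split=> //.
  by case: kd => /= [/sw/wr|/wr|]; exact: fin.
have lo q : Pr q -> (p0%:E <= q)%E.
  move=> /rc cl.
  have cl' : closed [set q : \bar R | (p0%:E <= q)%E] by exact: closed_ereal_le_ereal.
  have : closure [set q : \bar R | (p0%:E <= q)%E] q.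
    by move: cl; apply: closure_subset => r; case: Es => -> //= /ltW.
  by rewrite -(proj1 (closure_id _) cl').
have up q : (p0%:E < q)%E -> Ps q by case: Es => -> //= /ltW.
have E kd p : by_kind Ps Pw Pr kd p%:E <-> p0 < p \/ p = p0 /\ by_kind Ps Pw Pr kd p0%:E.
  split=> [H|[lt|[-> //]]].
    have : Pr p%:E by case: kd H => //= [/sw/wr|/wr].
    move/lo; rewrite lee_fin le_eqVlt => /orP[/eqP e|lt]; [right|by left].
    by subst p.
  have := up p%:E; rewrite lte_fin => /(_ lt).
  by case: kd => //= [/sw|/sw/wr].
suff [G [e r ee]] : exists G : nat -> gadget R, exists2 e : kind -> Prop,
    realizes G (fun kd p => p0 < p \/ p = p0 /\ e kd) &
    forall kd, e kd <-> by_kind Ps Pw Pr kd p0%:E.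
  exists G; apply: realizes_ext r => kd p _.
  rewrite E; split=> [[|[-> /ee]]|[|[-> /ee]]]; by [left|right].
have [hr|nr] := pselect (Pr p0%:E); last first.
  exists (@star R (diag (fun k => (k.+1 * count p0 k)%N))), (fun=> False).
    exact: star_none.
  case=> /=; split=> // H; apply: nr.
  - exact/wr/sw.
  - exact/wr.
have [hw|nw] := pselect (Pw p0%:E); last first.
  (* If p0 were 1, [Pr] would be the full range and then so would [Pw], against [nw]. The ratio c of
     the tree is defined through p0 > 1. *)
  have p0_gt1 : 1 < p0.
    move: p01; rewrite le_eqVlt => /orP[/eqP e|//]; subst p0; exfalso; apply: nw.
    have e : Pr = full_range.
      apply/seteqP; split=> q; first exact: lo.
      by rewrite /full_range /= le_eqVlt => /orP[/eqP <-//|/up/sw/wr].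
    by rewrite full // /full_range /= lexx.
  exists (tree p0_gt1), (fun kd => kd = Restr); first exact: tree_realizes.
  case=> /=; split=> // H; exfalso; apply: nw => //; exact: sw.
have [hs|ns] := pselect (Ps p0%:E).
  exists (@star R (diag (count p0))), (fun=> True); first exact: star_all.
  by case.
exists (@star R (fun _ => count p0)), (fun kd => kd <> Strong); first exact: star_weak.
by case; split.
Qed.

End Family.

(** * Blocks *)

Section Block.
Variable R : realType.
Variable g : gadget R.
Implicit Types (p lam C : R) (kd : kind).

(* Every leaf receives a companion point of tiny mass, so that the ball
   centred at the companion is exactly the cell of the leaf. *)
Definition block : finType := (hub g + (leaf g + leaf g))%type.

(** The inverse of a sum of reciprocals lies below every hub and leaf mass; the factor
    [#|leaf g|.+1] keeps even all the companions together below each of them. *)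
Definition comp_mass : R :=
  ((1 + \sum_(h : hub g) (hmass h)^-1 + \sum_(s : leaf g) (lmass s)^-1) * #|leaf g|.+1%:R)^-1.

Definition block_mass (x : block) : R :=
  match x with
  | inl h => hmass h
  | inr (inl s) => lmass s
  | inr (inr s) => comp_mass
  end.

Definition cell (s : leaf g) (x : block) : bool :=
  match x with
  | inl h => inc s h
  | inr (inl s') => s' == s
  | inr (inr s') => s' == s
  end.

Definition cell_avg (f : block -> R) (s : leaf g) : R :=
  (\sum_(x | cell s x) block_mass x * f x) / \sum_(x | cell s x) block_mass x.

Let N : R := #|leaf g|.+1%:R.

Lemma comp_mass_gt0 : 0 < comp_mass.
Proof.
rewrite invr_gt0 mulr_gt0 ?ltr0n // -addrA ltr_pwDl // addr_ge0 // sumr_ge0 // => x _.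
  by rewrite invr_ge0 ltW // hmass_gt0.
by rewrite invr_ge0 ltW // lmass_gt0.
Qed.

Lemma comp_mass_le m : 0 < m ->
  m^-1 <= 1 + \sum_(h : hub g) (hmass h)^-1 + \sum_(s : leaf g) (lmass s)^-1 ->
  comp_mass * N <= m.
Proof.
move=> m0 le; rewrite /comp_mass invfM mulfVK ?pnatr_eq0 //.
rewrite -[leRHS]invrK lef_pV2 // posrE ?invr_gt0 //.
by apply: lt_le_trans le; rewrite invr_gt0.
Qed.

Lemma comp_mass_le_hub h : comp_mass * N <= hmass (g := g) h.
Proof.
apply: comp_mass_le; first exact: hmass_gt0.
rewrite (bigD1 h) //= -!addrA addrCA lerDl !addr_ge0 // sumr_ge0 // => x _.
  by rewrite invr_ge0 ltW // hmass_gt0.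
by rewrite invr_ge0 ltW // lmass_gt0.
Qed.

Lemma comp_mass_le_leafN (s : leaf g) : comp_mass * N <= lmass s.
Proof.
apply: comp_mass_le; first exact: lmass_gt0.
rewrite [X in _ <= _ + X](bigD1 s) //= addrCA lerDl !addr_ge0 // sumr_ge0 // => x _.
  by rewrite invr_ge0 ltW // hmass_gt0.
by rewrite invr_ge0 ltW // lmass_gt0.
Qed.

Lemma comp_mass_le_leaf (s : leaf g) : comp_mass <= lmass s.
Proof.
apply: le_trans (comp_mass_le_leafN s).
by rewrite ler_peMr ?(ltW comp_mass_gt0) // ler1n.
Qed.

Lemma block_mass_gt0 x : 0 < block_mass x.
Proof.
by case: x => [h|[s|s]] /=; rewrite ?hmass_gt0 ?lmass_gt0 ?comp_mass_gt0.
Qed.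

Lemma block_sum (F : block -> R) :
  \sum_x F x = \sum_h F (inl h) + (\sum_s F (inr (inl s)) + \sum_s F (inr (inr s))).
Proof. by rewrite !big_sumType. Qed.

Lemma cell_sum (F : block -> R) s :
  \sum_(x | cell s x) F x =
  \sum_(h | inc s h) F (inl h) + (F (inr (inl s)) + F (inr (inr s))).
Proof. by rewrite !big_sumType /= !big_pred1_eq. Qed.

Lemma cell_mass_le s : \sum_(x | cell s x) block_mass x <= 3 * lmass s.
Proof.
rewrite cell_sum /=; have := hmass_le s; have := comp_mass_le_leaf s; lra.
Qed.

Lemma lmass_le_cell s : lmass s <= \sum_(x | cell s x) block_mass x.
Proof.
rewrite cell_sum /= addrCA lerDl addr_ge0 ?(ltW comp_mass_gt0) //.
by apply: sumr_ge0 => h _; rewrite ltW // hmass_gt0.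
Qed.

Lemma cell_mass_gt0 s : 0 < \sum_(x | cell s x) block_mass x.
Proof. exact: lt_le_trans (lmass_gt0 s) (lmass_le_cell s). Qed.

Lemma cell_avg_ge0 f s : (forall x, 0 <= f x) -> 0 <= cell_avg f s.
Proof.
move=> f0; rewrite divr_ge0 ?(ltW (cell_mass_gt0 s)) // sumr_ge0 // => x _.
by rewrite mulr_ge0 // ltW // block_mass_gt0.
Qed.

Lemma cell_avg_le f s : (forall x, 0 <= f x) ->
  cell_avg f s <= transfer (fun h => f (inl h)) s +
    (f (inr (inl s)) + comp_mass / lmass s * f (inr (inr s))).
Proof.
move=> f0; have m0 := lmass_gt0 s.
have n0 : 0 <= \sum_(x | cell s x) block_mass x * f x.
  by apply: sumr_ge0 => x _; rewrite mulr_ge0 // ltW // block_mass_gt0.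
apply: (@le_trans _ _ ((\sum_(x | cell s x) block_mass x * f x) / lmass s)).
  rewrite ler_wpM2l // lef_pV2 ?posrE ?cell_mass_gt0 //; exact: lmass_le_cell.
rewrite cell_sum /= /transfer !mulrDl lerD2l.
by rewrite (mulrC (lmass s)) mulfK ?gt_eqF // mulrAC.
Qed.

(** The average is at most the maximum, hence the unweighted sum; the lost weights are paid for by
    the tiny companion mass. *)
Lemma cell_avg_powR p f s : 0 < p -> (forall x, 0 <= f x) ->
  cell_avg f s `^ p <= \sum_(x | cell s x) f x `^ p.
Proof.
move=> p0 f0; pose M : R := \big[Num.max/0]_(x | cell s x) f x.
have le : cell_avg f s <= M.
  rewrite ler_pdivrMr ?cell_mass_gt0 // mulr_sumr; apply: ler_sum => x sx.
  by rewrite mulrC ler_wpM2r ?(ltW (block_mass_gt0 x)) // /M (bigmax_sup x).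
apply: le_trans (powR_mono (ltW p0) (cell_avg_ge0 s f0) le) _.
apply: le_trans (@gauge_sum R Strong p 1 _ _ _ _ _) _ => /=.
by rewrite powR0 ?add0r // gt_eqF.
Qed.

(** After exchanging the sums, the value at s is charged with the mass of the points that see it,
    all within its cell. *)
Lemma sum_visible (vis : block -> leaf g -> bool) (U : leaf g -> R) :
  (forall x s, vis x s -> cell s x) -> (forall s, 0 <= U s) ->
  \sum_x block_mass x * \sum_(s | vis x s) U s <= \sum_s 3 * (lmass s * U s).
Proof.
move=> sub U0.
apply: (@le_trans _ _ (\sum_x \sum_(s | cell s x) block_mass x * U s)).
  apply: ler_sum => x _; rewrite -mulr_sumr ler_wpM2l ?(ltW (block_mass_gt0 x)) //.
  rewrite big_mkcond [leRHS]big_mkcond; apply: ler_sum => s _ /=.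
  by case: ifP => [/sub ->//|_]; case: ifP.
rewrite (exchange_big_dep xpredT) //=; apply: ler_sum => s _.
by rewrite -mulr_suml mulrA ler_wpM2r // cell_mass_le.
Qed.

(** [vis x s] means that the maximal function at x may use the cell of s. The cell average splits
    into the transfer and the values at the leaf and its companion; the last two are controlled by
    [f] itself. *)
Lemma visible_bound kd p C (vis : block -> leaf g -> bool) (f : block -> R) lam :
  1 <= p -> 0 < lam -> transfer_bound kd p C g ->
  (forall x s, vis x s -> cell s x) -> (forall x, 0 <= f x) -> admissible kd p f ->
  \sum_x block_mass x * \sum_(s | vis x s) gauge kd p lam (cell_avg f s) <=
  3 * 2 `^ p * (`|C| + 2 `^ p) * \sum_x block_mass x * f x `^ p.
Proof.
move=> p1 l0 B sub f0 adm; have p_gt0 : 0 < p := lt_le_trans ltr01 p1.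
have p_ge0 := ltW p_gt0.
apply: le_trans (sum_visible sub (fun s => gauge_ge0 _ _ _ _)) _.
rewrite -mulr_sumr -!mulrA ler_wpM2l //.
have l20 : 0 < lam / 2 by rewrite divr_gt0.
have le s : lmass s * gauge kd p lam (cell_avg f s) <=
    2 `^ p * (lmass s * gauge kd p (lam / 2) (transfer (fun h => f (inl h)) s) +
     2 `^ p * (lmass s * f (inr (inl s)) `^ p + comp_mass * f (inr (inr s)) `^ p)).
  set T := transfer _ _; set u := f (inr (inl s)); set v := f (inr (inr s)).
  have m0 := lmass_gt0 s.
  have e0 : 0 < comp_mass / lmass s by rewrite divr_gt0 // comp_mass_gt0.
  have T0 : 0 <= T by exact: transfer_ge0.
  have ev0 : 0 <= comp_mass / lmass s * v by exact: mulr_ge0 (ltW e0) (f0 _).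
  have w0 : 0 <= u + comp_mass / lmass s * v by exact: addr_ge0 (f0 _) ev0.
  have := gauge_mono kd lam p_ge0 (cell_avg_ge0 s f0) (cell_avg_le s f0).
  move=> /le_trans /(_ (gaugeD _ p_ge0 T0 w0 l0)) h1.
  have h2 := gauge_le_powR kd l20 p_ge0 w0.
  have h3 := @gaugeD R Strong p 1 _ _ p_ge0 (f0 (inr (inl s))) ev0 ltr01.
  rewrite /= -/u in h3.
  (* The mass ratio is at most 1, so its p-th power is at most itself, which trades leaf mass for
     companion mass. *)
  have h4 : lmass s * (comp_mass / lmass s * v) `^ p <= comp_mass * v `^ p.
    rewrite (powRM p (ltW e0) (f0 _)) mulrA ler_wpM2r ?powR_ge0 //.
    rewrite mulrC -ler_pdivlMr // ge1r_powR // e0 /=.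
    by rewrite ler_pdivrMr // mul1r comp_mass_le_leaf.
  apply: le_trans (ler_wpM2l (ltW m0) h1) _.
  rewrite mulrCA ler_wpM2l ?powR_ge0 // mulrDr lerD2l.
  apply: le_trans (ler_wpM2l (ltW m0) (le_trans h2 h3)) _.
  by rewrite mulrCA ler_wpM2l ?powR_ge0 // mulrDr lerD2l.
apply: le_trans (ler_sum _ (fun s _ => le s)) _.
rewrite -mulr_sumr ler_wpM2l ?powR_ge0 // big_split /= -mulr_sumr big_split /=.
have adm' : admissible kd p (fun h : hub g => f (inl h)).
  by move=> e; case: (adm e) => [|f01]; [left|right=> h].
have hT := B (fun h => f (inl h)) (fun h => f0 _) adm' _ l20.
rewrite block_sum /=.
pose A := \sum_(h : hub g) hmass h * f (inl h) `^ p.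
pose S2 := \sum_(s : leaf g) lmass s * f (inr (inl s)) `^ p.
pose S3 := \sum_(s : leaf g) comp_mass * f (inr (inr s)) `^ p.
rewrite -/A in hT; rewrite -/A -/S2 -/S3.
have A0 : 0 <= A by apply: sumr_ge0 => h _; rewrite mulr_ge0 ?powR_ge0 // ltW // hmass_gt0.
have S20 : 0 <= S2 by apply: sumr_ge0 => h _; rewrite mulr_ge0 ?powR_ge0 // ltW // lmass_gt0.
have S30 : 0 <= S3 by apply: sumr_ge0 => h _; rewrite mulr_ge0 ?powR_ge0 // ltW // comp_mass_gt0.
have hC : C * A <= `|C| * A by rewrite ler_wpM2r // ler_norm.
rewrite mulrDl; apply: lerD.
  apply: le_trans hT (le_trans hC _); rewrite ler_wpM2l // lerDl; exact: addr_ge0.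
by rewrite ler_wpM2l ?powR_ge0 // lerDr.
Qed.

(** True for every gadget with constant 1: each cell is seen with companion mass only, a point lies
    in at most [#|leaf g|] cells, and that many companions weigh no more than any hub or leaf. *)
Lemma visible_comp_bound kd p (vis : block -> leaf g -> bool) (f : block -> R) lam :
  1 <= p -> 0 < lam ->
  (forall x s, vis x s -> x = inr (inr s)) -> (forall x, 0 <= f x) ->
  \sum_x block_mass x * \sum_(s | vis x s) gauge kd p lam (cell_avg f s) <=
  \sum_x block_mass x * f x `^ p.
Proof.
move=> p1 l0 sub f0; have p_gt0 : 0 < p := lt_le_trans ltr01 p1.
apply: (@le_trans _ _ (\sum_(s : leaf g) comp_mass * \sum_(x | cell s x) f x `^ p)).
  apply: (@le_trans _ _ (\sum_x \sum_(s | x == inr (inr s)) comp_mass * cell_avg f s `^ p)).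
    apply: ler_sum => x _; rewrite mulr_sumr big_mkcond [leRHS]big_mkcond.
    apply: ler_sum => s _ /=; case: ifP => [/sub ->|_].
      rewrite eqxx ler_wpM2l ?(ltW comp_mass_gt0) // gauge_le_powR // ?cell_avg_ge0 //.
      exact: ltW.
    by case: ifP => // _; rewrite mulr_ge0 ?powR_ge0 // ltW // comp_mass_gt0.
  rewrite (exchange_big_dep xpredT) //=; apply: ler_sum => s _.
  by rewrite big_pred1_eq ler_wpM2l ?(ltW comp_mass_gt0) // cell_avg_powR.
under eq_bigr => s _ do rewrite mulr_sumr.
rewrite (exchange_big_dep xpredT) //=; apply: ler_sum => x _.
rewrite -mulr_suml ler_wpM2r ?powR_ge0 // sumr_const.
have card_le : comp_mass *+ #|[pred s | cell s x]| <= comp_mass * N.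
  rewrite -mulr_natr ler_wpM2l ?(ltW comp_mass_gt0) // ler_nat.
  exact: leq_trans (max_card _) (leqnSn _).
case: x card_le => [h|[s|s]] /= le.
- exact: le_trans le (comp_mass_le_hub h).
- exact: le_trans le (comp_mass_le_leafN s).
(* A companion lies in its own cell only. *)
- rewrite (_ : #|_| = 1%N) ?mulr1n // -(card1 s).
  by apply: eq_card => s'; rewrite !inE eq_sym.
Qed.

Definition extend0 (f : hub g -> R) (x : block) : R := if x is inl h then f h else 0.

Lemma extend0_sum p f : 0 < p ->
  \sum_x block_mass x * extend0 f x `^ p = \sum_h hmass h * f h `^ p.
Proof.
move=> p0; rewrite block_sum /= [X in _ + (X + _)]big1 ?[X in _ + (_ + X)]big1 ?addr0 //.
  by move=> s _; rewrite powR0 ?mulr0 // gt_eqF.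
by move=> s _; rewrite powR0 ?mulr0 // gt_eqF.
Qed.

Lemma extend0_ge0 f : (forall h, 0 <= f h) -> forall x, 0 <= extend0 f x.
Proof. by move=> f0 [h|[s|s]] /=. Qed.

Lemma transfer_le_cell_avg f s : (forall h, 0 <= f h) ->
  transfer f s <= 3 * cell_avg (extend0 f) s.
Proof.
move=> f0; rewrite /transfer /cell_avg (cell_sum (fun x => block_mass x * extend0 f x)) /= !mulr0 !addr0.
set A := \sum_(h | inc s h) hmass h * f h.
have A0 : 0 <= A by apply: sumr_ge0 => h _; rewrite mulr_ge0 // ltW // hmass_gt0.
rewrite mulrCA ler_wpM2l // -[leRHS]invrK lef_pV2 ?posrE ?lmass_gt0 //.
  by rewrite invfM invrK mulrC ler_pdivrMr // mulrC cell_mass_le.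
by rewrite invr_gt0 divr_gt0 // cell_mass_gt0.
Qed.

End Block.

(** * The space *)

(** [None] is the centre. *)
Definition space (R : realType) (G : nat -> gadget R) : Type :=
  option {k : nat & block (G k)}.

Section SpaceInstances.
Variables (R : realType) (G : nat -> gadget R).

HB.instance Definition _ := Choice.on (space G).
HB.instance Definition _ := isPointed.Build (space G) (None : space G).
HB.instance Definition _ := @isMeasurable.Build default_measure_display
  (space G) discrete_measurable discrete_measurable0
  discrete_measurableC discrete_measurableU.

End SpaceInstances.

Section Measure.
Context {R : realType} {G : nat -> gadget R}.
Notation X := (space G).
Implicit Types (k : nat) (A : set X) (F H : X -> \bar R).

Definition pt k (x : block (G k)) : X := Some (Tagged (fun k => block (G k)) x).

Lemma pt_inj k : injective (@pt k).
Proof. by move=> x y [] /eqP; rewrite eq_Tagged => /eqP. Qed.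

Lemma space_measurable A : measurable A. Proof. by []. Qed.

(* The total mass of all the blocks is at most 1. *)
Definition scale k : R := ((2 ^+ k.+1) * (1 + \sum_(x : block (G k)) block_mass x))^-1.

Lemma block_total_ge0 k : 0 <= \sum_(x : block (G k)) block_mass x.
Proof. by apply: sumr_ge0 => x _; rewrite ltW // block_mass_gt0. Qed.

Lemma scale_gt0 k : 0 < scale k.
Proof.
by rewrite invr_gt0 mulr_gt0 ?exprn_gt0 // ltr_pwDl // block_total_ge0.
Qed.

Definition mass k (x : block (G k)) : R := scale k * block_mass x.

Lemma mass_gt0 k (x : block (G k)) : 0 < mass x.
Proof. by rewrite mulr_gt0 ?scale_gt0 ?block_mass_gt0. Qed.

Lemma mass_ge0 k (x : block (G k)) : 0 <= mass x.
Proof. exact/ltW/mass_gt0. Qed.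

Lemma sum_mass_le k : \sum_(x : block (G k)) mass x <= (2 ^+ k.+1)^-1.
Proof.
rewrite -mulr_sumr /scale invfM -mulrA ler_piMr ?invr_ge0 ?exprn_ge0 //.
have := block_total_ge0 k; move: (\sum_x _) => S S0.
rewrite mulrC ler_pdivrMr ?mul1r; last by rewrite ltr_pwDl.
by rewrite lerDr.
Qed.

(** An enumeration, so that the block measure is a finite [msum] of Dirac masses; indices below
    [#|block (G k)|] never meet the default. *)
Definition block_item k (i : nat) : block (G k) :=
  nth (inl (hub0 (G k))) (enum (block (G k))) i.

Definition block_measure k : {measure set X -> \bar R} :=
  msum (fun i => mscale (NngNum (mass_ge0 (block_item k i)))
    (@dirac _ _ (pt (block_item k i)) R)) #|block (G k)|.

Definition space_measure : {measure set X -> \bar R} :=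
  measure_add (@dirac _ _ (None : X) R) (mseries block_measure 0).

Notation mu := space_measure.

Lemma integral_block_measure k F : (forall x, (0 <= F x)%E) ->
  (\int[block_measure k]_y F y = \sum_(x : block (G k)) (mass x)%:E * F (pt x))%E.
Proof.
move=> F0; rewrite /block_measure ge0_integral_measure_sum //.
under eq_bigr => i _.
  rewrite ge0_integral_mscale // integral_dirac // diracT mul1e /=.
  over.
rewrite -(big_mkord xpredT (fun i => (mass (block_item k i))%:E * F (pt (block_item k i)))%E).
rewrite cardE -(big_nth (inl (hub0 (G k))) xpredT (fun x => (mass x)%:E * F (pt x))%E).
by rewrite big_enum.
Qed.

Lemma integral_space F : (forall x, (0 <= F x)%E) ->
  (\int[mu]_y F y = F None +
    \sum_(0 <= k <oo) \sum_(x : block (G k)) (mass x)%:E * F (pt x))%E.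
Proof.
move=> F0; rewrite /space_measure ge0_integral_measure_add //.
rewrite integral_dirac // diracT mul1e; congr (_ + _)%E.
rewrite ge0_integral_measure_series //.
by apply: eq_eseriesr => k _; rewrite integral_block_measure.
Qed.

Lemma block_sum_ge0 k F : (forall x, (0 <= F x)%E) ->
  (0 <= \sum_(x : block (G k)) (mass x)%:E * F (pt x))%E.
Proof. by move=> F0; apply: sume_ge0 => x _; rewrite mule_ge0 // lee_fin mass_ge0. Qed.

Lemma le_integral_blocks F H : (forall x, (0 <= F x)%E) -> (forall x, (0 <= H x)%E) ->
  (F None <= H None)%E ->
  (forall k, \sum_(x : block (G k)) (mass x)%:E * F (pt x) <=
             \sum_(x : block (G k)) (mass x)%:E * H (pt x))%E ->
  (\int[mu]_y F y <= \int[mu]_y H y)%E.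
Proof.
move=> F0 H0 le0 le; rewrite !integral_space // leeD //.
by apply: lee_nneseries => // k _ _; exact: block_sum_ge0.
Qed.

Lemma integral_one_block k F : (forall x, (0 <= F x)%E) -> F None = 0%E ->
  (forall j (x : block (G j)), j != k -> F (pt x) = 0%E) ->
  (\int[mu]_y F y = \sum_(x : block (G k)) (mass x)%:E * F (pt x))%E.
Proof.
move=> F0 FN Fj; rewrite integral_space // FN add0e (@nneseriesD1 _ _ k) //; last first.
  by move=> j _; exact: block_sum_ge0.
rewrite eseries0 ?adde0 // => j _ /andP[_ jk].
by apply: big1 => x _; rewrite Fj // mule0.
Qed.

Lemma integral_ge_block k F : (forall x, (0 <= F x)%E) ->
  (\sum_(x : block (G k)) (mass x)%:E * F (pt x) <= \int[mu]_y F y)%E.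
Proof.
move=> F0; rewrite integral_space // (@nneseriesD1 _ _ k) //; last first.
  by move=> j _; exact: block_sum_ge0.
rewrite addeCA leeDl // adde_ge0 // nneseries_ge0 // => j _ _; exact: block_sum_ge0.
Qed.

Lemma integral_ge_center F : (forall x, (0 <= F x)%E) ->
  (F None <= \int[mu]_y F y)%E.
Proof.
move=> F0; rewrite integral_space // leeDl // nneseries_ge0 // => j _ _.
exact: block_sum_ge0.
Qed.

Definition in_block k (P : pred (block (G k))) : set X := [set pt x | x in [set x | P x]].

Lemma integral_in_block k (P : pred (block (G k))) (f : X -> R) :
  (forall x, 0 <= f x) ->
  (\int[mu]_(y in in_block P) (f y)%:E = (\sum_(x | P x) mass x * f (pt x))%:E)%E.
Proof.
move=> f0; rewrite integral_mkcond (@integral_one_block k); first last.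
- move=> j x jk; rewrite patchE memNset // => -[y _ e].
  have /= ek := congr1 (fun u : X => if u is Some t then tag t else k) e.
  by move: jk; rewrite -ek eqxx.
- by rewrite patchE memNset // => -[].
- by move=> x; rewrite patchE; case: ifP => _; rewrite ?lee_fin.
rewrite -sumEFin [RHS]big_mkcond /=; apply: eq_bigr => x _; rewrite patchE.
case: (boolP (P x)) => Px; first by rewrite mem_set //; exists x.
by rewrite memNset ?mule0 // => -[y Py /pt_inj e]; move: Px; rewrite -e Py.
Qed.

Lemma measure_in_block k (P : pred (block (G k))) :
  mu (in_block P) = (\sum_(x | P x) mass x)%:E.
Proof.
rewrite -[LHS]mul1e -integral_cst //.
rewrite (integral_in_block P (fun=> ler01)).
by congr EFin; apply: eq_bigr => x _; rewrite mulr1.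
Qed.

Lemma measure_center A : A None -> (1 <= mu A)%E.
Proof.
move=> AN; rewrite -[leRHS]mul1e -integral_cst // integral_mkcond.
apply: le_trans (integral_ge_center _); first by rewrite patchE mem_set.
by move=> x; rewrite patchE; case: ifP.
Qed.

Lemma measure_pt A k (x : block (G k)) : A (pt x) -> ((mass x)%:E <= mu A)%E.
Proof.
move=> Ax; have -> : (mass x)%:E = mu (in_block (pred1 x)).
  by rewrite measure_in_block big_pred1_eq.
by apply: le_measure; rewrite ?inE // => _ [y /eqP -> <-].
Qed.

Lemma measure_gt0 A x : A x -> (0 < mu A)%E.
Proof.
case: x => [[k x]|] Ax; last exact: lt_le_trans (measure_center Ax).
by apply: lt_le_trans (measure_pt (x := x) Ax); rewrite lte_fin mass_gt0.
Qed.

Lemma measure_total : (mu [set: X] <= 2%:E)%E.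
Proof.
rewrite -[X in (X <= _)%E]mul1e -integral_cst // integral_space //.
have -> : (2%:E = 1 + 1 :> \bar R)%E by rewrite -EFinD.
rewrite leeD //.
have := @cvg_geometric_eseries_half R 1 0; rewrite expr0 divr1 => /cvg_lim e.
rewrite -[leRHS]e //.
apply: lee_nneseries => [k _ _|k _].
  exact: (@block_sum_ge0 k (cst 1%E)).
under eq_bigr do rewrite mule1.
by rewrite sumEFin lee_fin mul1r natrX addn1 sum_mass_le.
Qed.

Lemma measure_lty A : (mu A < +oo)%E.
Proof.
apply: (@le_lt_trans _ _ 2%:E); last exact: ltry.
by apply: le_trans measure_total; apply: le_measure; rewrite ?inE.
Qed.

Lemma measure_pos_fine A x : A x -> 0 < fine (mu A).
Proof. by move=> Ax; rewrite fine_gt0 // (measure_gt0 Ax) measure_lty. Qed.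

End Measure.

(** * Balls and averages *)

Section Metric.
Context {R : realType} {G : nat -> gadget R}.
Variable flag : nat -> bool.
Notation X := (space G).
Notation mu := (@space_measure R G).
Implicit Types (k : nat) (u v w : X) (f : X -> R) (s t : R).

(** [flag k] detaches the leaves of block k from the centre; the ball of radius 2 about such a leaf
    is then its cell, within reach of the centered operator. *)
Definition center_adj k (x : block (G k)) : bool :=
  match x with
  | inl _ => true
  | inr (inl _) => ~~ flag k
  | inr (inr _) => false
  end.

Definition owner (g : gadget R) (a : leaf g + leaf g) : leaf g :=
  match a with inl s => s | inr s => s end.

Definition block_near (g : gadget R) (x y : block g) : bool :=
  match x, y with
  | inl h, inl h' => h == h'
  | inl h, inr a | inr a, inl h => inc (owner a) h
  | inr a, inr b => owner a == owner b
  end.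

Definition near u v : bool :=
  match u, v with
  | None, None => true
  | None, Some t | Some t, None => center_adj (tagged t)
  | Some t, Some t' => (tag t == tag t') && block_near (tagged t) (tagged_as t t')
  end.

(** With nonzero distances 1 and 2 the triangle inequality is automatic, and the graph [near] can be
    chosen freely. *)
Definition rho u v : R := if u == v then 0 else if near u v then 1 else 2.

Lemma space_ind (P : X -> Prop) :
  P None -> (forall k (x : block (G k)), P (pt x)) -> forall u, P u.
Proof. by move=> PN Pp [[k x]|]; [exact: Pp|]. Qed.

Lemma near_pt k (x y : block (G k)) : near (pt x) (pt y) = block_near x y.
Proof. by rewrite /near /= eqxx tagged_asE. Qed.

Lemma near_center k (x : block (G k)) : near (pt x) None = center_adj x.
Proof. by []. Qed.

Lemma near_diff k j (x : block (G k)) (y : block (G j)) :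
  k != j -> near (pt x) (pt y) = false.
Proof. by rewrite /near /= => /negPf ->. Qed.

Lemma block_near_sym (g : gadget R) (x y : block g) : block_near x y = block_near y x.
Proof. by case: x y => [h|a] [h'|b] //=; rewrite eq_sym. Qed.

Lemma near_refl u : near u u.
Proof.
by elim/space_ind: u => // k x; rewrite near_pt; case: x => [h|a] /=.
Qed.

Lemma near_sym u v : near u v = near v u.
Proof.
elim/space_ind: u => [|k x]; elim/space_ind: v => [|j y] //.
have [e|ne] := eqVneq k j; last by rewrite !near_diff // eq_sym.
by subst j; rewrite !near_pt block_near_sym.
Qed.

Lemma rho_ge0 u v : 0 <= rho u v.
Proof. by rewrite /rho; case: eqP => // _; case: ifP. Qed.

Lemma rho_gt1 u v : u != v -> 1 <= rho u v.
Proof. by rewrite /rho => /negPf ->; case: ifP => // _; rewrite ler1n. Qed.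

Lemma rho_le2 u v : rho u v <= 2.
Proof. by rewrite /rho; case: eqP => // _; case: ifP => // _; rewrite ler1n. Qed.

Lemma rho_xx u : rho u u = 0. Proof. by rewrite /rho eqxx. Qed.

Lemma rho_sym u v : rho u v = rho v u.
Proof. by rewrite /rho eq_sym near_sym. Qed.

Lemma rho_metric : is_metric rho.
Proof.
split; [exact: rho_ge0| |exact: rho_sym|].
- move=> u v; split=> [|->]; last exact: rho_xx.
  have [//|/rho_gt1] := eqVneq u v.
  by move=> le e; move: le; rewrite e ler10.
- move=> u v w; have [->|uv] := eqVneq u v; first by rewrite rho_xx add0r.
  have [->|vw] := eqVneq v w; first by rewrite rho_xx addr0.
  have := rho_gt1 uv; have := rho_gt1 vw; have := rho_le2 u w; lra.
Qed.

Lemma rball_small u s : 0 < s -> s <= 1 -> rball rho u s = [set u].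
Proof.
move=> s0 s1; apply/seteqP; split=> v /=; last by move=> ->; rewrite /rball /= rho_xx.
move=> lt; apply: contra_ltP lt => /eqP; rewrite eq_sym => /rho_gt1.
exact: le_trans.
Qed.

Lemma rball_mid u s : 1 < s -> s <= 2 -> rball rho u s = [set v | near u v].
Proof.
move=> s1 s2; apply/seteqP; split=> v; rewrite /rball /= /rho.
  case: eqP => [->|_]; first by rewrite near_refl.
  by case: ifP => // _ /lt_le_trans /(_ s2); rewrite ltxx.
move=> ->; case: eqP => // _; exact: lt_trans s1.
Qed.

Lemma rball_big u s : 2 < s -> rball rho u s = [set: X].
Proof.
by move=> s2; apply/seteqP; split=> v //= _; apply: le_lt_trans (rho_le2 _ _) s2.
Qed.

Lemma near_cell k (a : leaf (G k) + leaf (G k)) :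
  ~~ center_adj (inr a : block (G k)) ->
  [set v | near (pt (inr a : block (G k))) v] = in_block (cell (owner a)).
Proof.
move=> na; apply/seteqP; split=> v; last first.
  by case=> y cy <-; rewrite /mkset near_pt; case: y cy => [h|[s|s]] //= /eqP ->.
elim/space_ind: v => [|j y]; first by rewrite /mkset near_center (negPf na).
rewrite /mkset.
have [e|ne] := eqVneq k j; last by rewrite near_diff.
subst j; rewrite near_pt => xy; exists y => //.
by case: y xy => [h|[s|s]] //= /eqP ->.
Qed.

(** Radii up to 1, up to 2 and beyond give the point, its neighbourhood and the whole space. Hubs
    are adjacent to the centre, so only the neighbourhood of a leaf or companion can miss it. *)
Lemma rball_cases u s : 0 < s ->
  [\/ rball rho u s = [set u], rball rho u s None |
   exists k (a : leaf (G k) + leaf (G k)),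
     [/\ u = pt (inr a : block (G k)), ~~ center_adj (inr a : block (G k)) &
         rball rho u s = in_block (cell (owner a))]].
Proof.
move=> s0; have [s1|s1] := leP s 1; first by constructor 1; exact: rball_small.
have [s2|s2] := leP s 2; last by constructor 2; rewrite rball_big.
rewrite (rball_mid u s1 s2); elim/space_ind: u => [|k x]; first by constructor 2.
have [ad|na] := boolP (center_adj x); first by constructor 2.
case: x na => [//|a] na; constructor 3; exists k, a; split=> //.
exact: near_cell.
Qed.

Lemma rball_cell k (a : leaf (G k) + leaf (G k)) :
  ~~ center_adj (inr a : block (G k)) ->
  rball rho (pt (inr a : block (G k))) 2 = in_block (cell (owner a)).
Proof. by move=> na; rewrite rball_mid ?ltr1n // near_cell. Qed.

Lemma rball_self u s : 0 < s -> rball rho u s u.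
Proof. by rewrite /rball /= rho_xx. Qed.

Lemma space_mms : metric_measure_space rho mu.
Proof.
split; [exact: rho_metric| |].
(* Singletons are balls, so every set is open and the discrete sigma-algebra is the Borel one. *)
- move=> A; split=> // _; apply: sub_gen_smallest => u Au.
  by exists 1 => //; rewrite rball_small // => v ->.
- by move=> u s s0; split; [exact: measure_gt0 (rball_self u s0)|exact: measure_lty].
Qed.

Lemma space_not_doubling : ~ doubling rho mu.
Proof.
case=> C dC; have [k] := @expr_unbounded R 2 C (ltac:(by rewrite ltr1n)).
rewrite ltNge => /negP; apply.
(* A hub of block k weighs at most 2^-(k+1), while its ball of radius 2 contains the centre, of mass
   1. *)
pose x : block (G k) := inl (hub0 (G k)).
have := dC (pt x) 1 ltr01; rewrite mulr1 (rball_small _ ltr01 (lexx 1)).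
have lt12 : (1 : R) < 2 by rewrite ltr1n.
rewrite (rball_mid _ lt12 (lexx 2)).
have -> : [set pt x] = in_block (pred1 x).
  by apply/seteqP; split=> [_ ->|_ [y /eqP -> <-]//]; exists x => /=.
rewrite measure_in_block big_pred1_eq => h.
have : (1 <= C%:E * (mass x)%:E)%E by apply: le_trans h; exact: measure_center.
rewrite -EFinM lee_fin => h1.
have mx : mass x <= (2 ^+ k.+1)^-1.
  have le : mass x <= \sum_(y : block (G k)) mass y.
    by rewrite (bigD1 x) //= lerDl sumr_ge0 // => y _; exact: mass_ge0.
  exact: le_trans le (sum_mass_le k).
have C0 : 0 <= C.
  rewrite leNgt; apply/negP => C0.
  have : C * mass x <= 0 by rewrite nmulr_rle0 // mass_ge0.
  by lra.
have : 1 <= C * (2 ^+ k.+1)^-1 by apply: le_trans h1 _; rewrite ler_wpM2l.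
rewrite ler_pdivlMr ?exprn_gt0 // mul1r; apply: le_trans.
by rewrite exprS ler_peMl ?exprn_ge0 // ler1n.
Qed.

End Metric.

(** * Pointwise bounds for the two maximal operators *)

Section Pointwise.
Context {R : realType} {G : nat -> gadget R}.
Variable flag : nat -> bool.
Notation X := (space G).
Notation mu := (@space_measure R G).
Notation rho := (@rho R G flag).
Implicit Types (k : nat) (u v w : X) (f : X -> R) (s t J M : R) (B : set X).

Lemma avg_le_of_integral B f u M : B u ->
  (\int[mu]_(y in B) (`|f y|)%:E <= M%:E * mu B)%E -> (avg mu B f <= M%:E)%E.
Proof.
move=> Bu le; have m0 := measure_pos_fine Bu.
have mE : mu B = (fine (mu B))%:E.
  by rewrite fineK // ge0_fin_numE ?measure_ge0 // measure_lty.
apply: (@le_trans _ _ (((fine (mu B))^-1)%:E * (M%:E * mu B))%E).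
  by rewrite /avg lee_wpmul2l // lee_fin invr_ge0 ltW.
rewrite [X in (_ * (_ * X))%E]mE -!EFinM lee_fin mulrCA mulVf ?mulr1 //.
by rewrite gt_eqF.
Qed.

Lemma avg_le B f u M : B u -> (forall v, `|f v| <= M) -> (avg mu B f <= M%:E)%E.
Proof.
move=> Bu fM; apply: (avg_le_of_integral Bu); rewrite -integral_cst //.
by apply: ge0_le_integral => // v _; rewrite lee_fin.
Qed.

Lemma avg_single f u : (avg mu [set u] f <= (`|f u|)%:E)%E.
Proof.
apply: (@avg_le_of_integral _ _ u) => //; rewrite -integral_cst //.
by apply: ge0_le_integral => // v -> .
Qed.

Lemma avg_single_ge f u : ((`|f u|)%:E <= avg mu [set u] f)%E.
Proof.
have m0 : 0 < fine (mu [set u]) by exact: (@measure_pos_fine _ _ _ u).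
have mE : mu [set u] = (fine (mu [set u]))%:E.
  by rewrite fineK // ge0_fin_numE ?measure_ge0 // measure_lty.
have : (((fine (mu [set u]))^-1)%:E * ((`|f u|)%:E * mu [set u]) <= avg mu [set u] f)%E.
  have i0 : (0 <= ((fine (mu [set u]))^-1)%:E)%E by rewrite lee_fin invr_ge0 ltW.
  rewrite /avg (lee_wpmul2l i0) // -integral_cst //.
  apply: ge0_le_integral => //; [by move=> v _; rewrite lee_fin|by move=> v ->].
apply: le_trans.
rewrite [X in (_ <= _ * (_ * X))%E]mE -!EFinM lee_fin mulrCA mulVf ?mulr1 //.
by rewrite gt_eqF.
Qed.

(** The centre gives B mass at least 1, so dividing by it does not increase the integral. *)
Lemma avg_center B f J : B None ->
  (\int[mu]_y (`|f y|)%:E = J%:E)%E -> (avg mu B f <= J%:E)%E.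
Proof.
move=> BN fJ; apply: (avg_le_of_integral BN).
have J0 : 0 <= J by rewrite -lee_fin -fJ; exact: integral_ge0.
apply: (@le_trans _ _ J%:E).
  by rewrite -fJ; apply: ge0_subset_integral => //.
rewrite -[leLHS]mule1 lee_wpmul2l ?lee_fin //; exact: measure_center.
Qed.

Definition block_part f k (x : block (G k)) : R := `|f (pt x)|.

Lemma avg_cell f k (s : leaf (G k)) :
  (avg mu (in_block (cell s)) f = (cell_avg (block_part f (k := k)) s)%:E)%E.
Proof.
rewrite /avg measure_in_block (integral_in_block _ (fun x => normr_ge0 (f x))).
rewrite -EFinM; congr EFin; rewrite /cell_avg mulrC.
have E (F : block (G k) -> R) : \sum_(x | cell s x) mass x * F x =
    scale (G := G) k * \sum_(x | cell s x) block_mass x * F x.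
  by rewrite mulr_sumr; apply: eq_bigr => x _; rewrite mulrA.
rewrite E /= -mulr_sumr invfM mulrACA mulfV ?mul1r //.
by rewrite gt_eqF // scale_gt0.
Qed.

Definition nvis k (x : block (G k)) (s : leaf (G k)) : bool := cell s x.

(** The cells that are balls centred at x itself. *)
Definition cvis k (x : block (G k)) (s : leaf (G k)) : bool :=
  if x is inr a then (owner a == s) && ~~ center_adj flag x else false.

(** One term for each case of [rball_cases]: the point, the balls through the centre, with [J] the
    L^1 norm, and the cells seen from u. *)
Definition majorant (vis : forall k, block (G k) -> leaf (G k) -> bool) f J (u : X) : R :=
  match u with
  | None => Num.max `|f None| J
  | Some t => \big[Num.max/Num.max `|f u| J]_(s | vis _ (tagged t) s)
                cell_avg (block_part f (k := tag t)) s
  end.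

Lemma majorant_pt vis f J k (x : block (G k)) :
  majorant vis f J (pt x) =
  \big[Num.max/Num.max `|f (pt x)| J]_(s | vis k x s) cell_avg (block_part f (k := k)) s.
Proof. by []. Qed.

Lemma majorant_norm vis f J u : `|f u| <= majorant vis f J u.
Proof.
elim/(@space_ind R G): u => [|k x] /=; first by rewrite le_max lexx.
by rewrite bigmax_idl le_max le_max lexx.
Qed.

Lemma majorant_total vis f J u : J <= majorant vis f J u.
Proof.
elim/(@space_ind R G): u => [|k x] /=; first by rewrite le_max lexx orbT.
by rewrite bigmax_idl le_max le_max lexx orbT.
Qed.

Lemma majorant_vis (vis : forall k, block (G k) -> leaf (G k) -> bool) f J k
    (x : block (G k)) (s : leaf (G k)) :
  vis k x s -> cell_avg (block_part f (k := k)) s <= majorant vis f J (pt x).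
Proof. by move=> v; rewrite majorant_pt (bigmax_sup s). Qed.

Lemma Mnoncent_le f J u : (\int[mu]_y (`|f y|)%:E = J%:E)%E ->
  (Mnoncent rho mu f u <= (majorant nvis f J u)%:E)%E.
Proof.
move=> fJ; apply: ub_ereal_sup => _ [y [s [s0 yu] ->]].
have Bu : rball rho y s u by exact: yu.
case: (rball_cases flag y s0) Bu => [->|BN|[k [a [-> na ->]]]] Bu.
- rewrite -Bu; apply: le_trans (avg_single f _) _.
  by rewrite lee_fin majorant_norm.
- by apply: le_trans (avg_center BN fJ) _; rewrite lee_fin majorant_total.
- rewrite avg_cell lee_fin; case: Bu => x cx <-; exact: majorant_vis.
Qed.

Lemma Mcent_le f J u : (\int[mu]_y (`|f y|)%:E = J%:E)%E ->
  (Mcent rho mu f u <= (majorant cvis f J u)%:E)%E.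
Proof.
move=> fJ; apply: ub_ereal_sup => _ [s s0 <-].
case: (rball_cases flag u s0) => [->|BN|[k [a [-> na ->]]]].
- by apply: le_trans (avg_single f _) _; rewrite lee_fin majorant_norm.
- by apply: le_trans (avg_center BN fJ) _; rewrite lee_fin majorant_total.
- rewrite avg_cell lee_fin; apply: majorant_vis.
  by rewrite /cvis eqxx.
Qed.

Lemma Mcent_norm f u : ((`|f u|)%:E <= Mcent rho mu f u)%E.
Proof.
apply: le_trans (avg_single_ge f u) _; apply: ereal_sup_ubound.
by exists 1 => //=; rewrite rball_small.
Qed.

Lemma Mcent_le_Mnoncent f u : (Mcent rho mu f u <= Mnoncent rho mu f u)%E.
Proof.
apply: le_ereal_sup => _ [s s0 <-]; exists u, s => //; split=> //.
exact: (rball_self flag u s0).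
Qed.

Lemma Mnoncent_norm f u : ((`|f u|)%:E <= Mnoncent rho mu f u)%E.
Proof. exact: le_trans (Mcent_norm f u) (Mcent_le_Mnoncent f u). Qed.

Lemma Mnoncent_bounded f M u : (forall v, `|f v| <= M) ->
  (Mnoncent rho mu f u <= M%:E)%E.
Proof.
move=> fM; apply: ub_ereal_sup => _ [y [s [s0 yu] ->]].
by apply: (@avg_le _ _ u).
Qed.

Lemma Mcent_bounded f M u : (forall v, `|f v| <= M) ->
  (Mcent rho mu f u <= M%:E)%E.
Proof. by move=> fM; exact: le_trans (Mcent_le_Mnoncent f u) (Mnoncent_bounded u fM). Qed.

Lemma Mnoncent_ge_cell f k (s : leaf (G k)) :
  ((cell_avg (block_part f (k := k)) s)%:E <=
   Mnoncent rho mu f (pt (inr (inl s) : block (G k))))%E.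
Proof.
rewrite -avg_cell; apply: ereal_sup_ubound.
have E := @rball_cell _ _ flag k (inr s) isT.
exists (pt (inr (inr s) : block (G k))), 2; last by rewrite E.
split=> //; suff : rball rho (pt (inr (inr s) : block (G k))) 2 (pt (inr (inl s) : block (G k))) by [].
by rewrite E; exists (inr (inl s)) => //=.
Qed.

Lemma Mcent_ge_cell f k (s : leaf (G k)) : flag k ->
  ((cell_avg (block_part f (k := k)) s)%:E <=
   Mcent rho mu f (pt (inr (inl s) : block (G k))))%E.
Proof.
move=> fk; rewrite -avg_cell; apply: ereal_sup_ubound.
have E : rball rho (pt (inr (inl s) : block (G k))) 2 = in_block (cell s).
  by rewrite (@rball_cell _ _ flag k (inl s)) //= fk.
by exists 2; [rewrite /= ltr0n|rewrite E].
Qed.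

End Pointwise.

(** * Types and transfer bounds *)

Section GaugeType.
Context {R : realType}.
Implicit Types (p lam C J M : R) (kd : kind).

Definition egauge kd p lam (u : \bar R) : \bar R :=
  if kd is Strong then (u `^ p)%E
  else if (lam%:E < u)%E then (lam `^ p)%:E else 0%E.

Lemma egauge_ge0 kd p lam u : (0 <= egauge kd p lam u)%E.
Proof.
by case: kd => /=; rewrite ?poweR_ge0 //; case: ifP => // _; rewrite lee_fin powR_ge0.
Qed.

Lemma egauge_EFin kd p lam (u : R) : egauge kd p lam u%:E = (gauge kd p lam u)%:E.
Proof.
by case: kd => //=; rewrite lte_fin; case: ltP => _; rewrite ?mulr1 ?mulr0.
Qed.

Lemma egauge_mono kd p lam (u v : \bar R) : 0 <= p -> (0 <= u)%E -> (u <= v)%E ->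
  (egauge kd p lam u <= egauge kd p lam v)%E.
Proof.
move=> p0 u0 uv.
have W : ((if (lam%:E < u)%E then (lam `^ p)%:E else 0) <=
          (if (lam%:E < v)%E then (lam `^ p)%:E else 0) :> \bar R)%E.
  case: ifP => [lu|_]; first by rewrite (lt_le_trans lu uv).
  by case: ifP => // _; rewrite lee_fin powR_ge0.
case: kd => //=; apply: gt0_ler_poweR => //; rewrite in_itv /= leey andbT //.
exact: le_trans uv.
Qed.

Context {G : nat -> gadget R}.
Notation X := (space G).
Notation mu := (@space_measure R G).

(** The type inequality raised to the power p: both sides are integrals and decompose over the
    blocks. *)
Definition gauge_type (T : (X -> R) -> X -> \bar R) kd p : Prop :=
  exists C, forall f : X -> R, (\int[mu]_y (`|f y| `^ p)%:E < +oo)%E ->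
  admissible kd p f -> forall lam, 0 < lam ->
  (\int[mu]_y egauge kd p lam (T f y) <= C%:E * \int[mu]_y (`|f y| `^ p)%:E)%E.

(** Above a, the quotient t/a is at most its p-th power. With the right a, this does the work of
    Hölder's inequality on a space of mass at most 2. *)
Lemma le_interpolate p a t : 1 <= p -> 0 < a -> 0 <= t -> t <= a + a / a `^ p * t `^ p.
Proof.
move=> p1 a0 t0; have [ta|at_] := leP t a.
  apply: le_trans ta _; rewrite lerDl mulr_ge0 ?powR_ge0 // divr_ge0 ?powR_ge0 //.
  exact: ltW.
apply: (@le_trans _ _ (a / a `^ p * t `^ p)); last by rewrite lerDr ltW.
have : t / a <= (t / a) `^ p.
  by apply: le1r_powR => //; rewrite ler_pdivlMr // mul1r ltW.
rewrite ler_pdivrMr // powRM ?invr_ge0 ?(ltW a0) // powR_inv ?(ltW a0) //.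
by move=> h; apply: le_trans h _; rewrite le_eqVlt; apply/orP; left; apply/eqP; ring.
Qed.

Lemma integral_le_interpolate p a A (f : X -> R) : 1 <= p -> 0 < a ->
  (\int[mu]_y (`|f y| `^ p)%:E = A%:E)%E ->
  (\int[mu]_y (`|f y|)%:E <= (2 * a + a / a `^ p * A)%:E)%E.
Proof.
move=> p1 a0 fA; have c0 : 0 <= a / a `^ p by rewrite divr_ge0 ?powR_ge0 // ltW.
apply: (@le_trans _ _ (\int[mu]_y (a%:E + (a / a `^ p)%:E * (`|f y| `^ p)%:E))%E).
  apply: ge0_le_integral => // x _.
  by rewrite -EFinM -EFinD lee_fin le_interpolate.
rewrite ge0_integralD //; last 2 first.
- by move=> x _; rewrite lee_fin ltW.
- by move=> x _; rewrite -EFinM lee_fin mulr_ge0 // powR_ge0.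
rewrite ge0_integralZl_EFin //.
rewrite fA integral_cst // EFinD EFinM leeD2r // EFinM muleC.
by apply: lee_wpmul2r; [rewrite lee_fin ltW|exact: measure_total].
Qed.

Lemma integral_finite_powR p A (f : X -> R) : 1 <= p ->
  (\int[mu]_y (`|f y| `^ p)%:E = A%:E)%E ->
  exists J, [/\ 0 <= J, (\int[mu]_y (`|f y|)%:E = J%:E)%E & J `^ p <= 3 `^ p * A].
Proof.
move=> p1 fA; have p_gt0 : 0 < p := lt_le_trans ltr01 p1.
have A0 : 0 <= A.
  by rewrite -lee_fin -fA; apply: integral_ge0 => x _; rewrite lee_fin powR_ge0.
have i0 : (0 <= \int[mu]_y (`|f y|)%:E)%E by exact: integral_ge0.
have fin : (\int[mu]_y (`|f y|)%:E)%E \is a fin_num.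
  rewrite ge0_fin_numE //.
  exact: le_lt_trans (integral_le_interpolate p1 ltr01 fA) (ltry _).
pose J := fine (\int[mu]_y (`|f y|)%:E)%E.
have JE : (\int[mu]_y (`|f y|)%:E = J%:E)%E by rewrite /J fineK.
have J0 : 0 <= J by rewrite fine_ge0.
exists J; split=> //.
have le a : 0 < a -> J <= 2 * a + a / a `^ p * A.
  by move=> a0; rewrite -lee_fin -JE; exact: integral_le_interpolate.
(* For A = 0 there is no optimal a, and a tends to 0 instead. *)
move: A0; rewrite le_eqVlt => /orP[/eqP e|A0].
  have -> : J = 0.
    apply/eqP; rewrite eq_le J0 andbT; apply/ler_addgt0Pr => e' e'0.
    have := le (e' / 2) (divr_gt0 e'0 (ltr0Sn R 1)); rewrite -e mulr0; lra.
  by rewrite powR0 ?gt_eqF // -e mulr0.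
(* This choice makes the second term equal to a, whence J <= 3a. *)
pose a := A `^ p^-1; have a0 : 0 < a by exact: powR_gt0.
have aA : a `^ p = A by rewrite -powRrM mulVf ?gt_eqF // powRr1 // ltW.
have J3 : J <= 3 * a by apply: le_trans (le _ a0) _; rewrite aA divfK ?gt_eqF //; lra.
apply: le_trans (powR_mono (ltW p_gt0) J0 J3) _.
by rewrite powRM ?(ltW a0) // aA.
Qed.

Lemma gauge_type_upper (T : (X -> R) -> X -> \bar R)
    (vis : forall k, block (G k) -> leaf (G k) -> bool) kd p D : 1 <= p ->
  (forall f u, (0 <= T f u)%E) ->
  (forall f J u, (\int[mu]_y (`|f y|)%:E = J%:E)%E -> (T f u <= (majorant vis f J u)%:E)%E) ->
  (forall k (f : block (G k) -> R) lam, 0 < lam -> (forall x, 0 <= f x) ->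
    admissible kd p f ->
    \sum_x block_mass x * \sum_(s | vis k x s) gauge kd p lam (cell_avg f s) <=
    D * \sum_x block_mass x * f x `^ p) ->
  gauge_type T kd p.
Proof.
move=> p1 T0 TU B; have p_ge0 : 0 <= p by exact: le_trans p1.
(* The 1 accounts for [f] itself, [|D|] for the visible cells, and the rest for the constant J on
   total mass at most 2. *)
exists (1 + `|D| + 2 * 3 `^ p) => f ffin adm lam l0.
pose A := fine (\int[mu]_y (`|f y| `^ p)%:E)%E.
have fA : (\int[mu]_y (`|f y| `^ p)%:E = A%:E)%E.
  rewrite /A fineK // ge0_fin_numE //.
  by apply: integral_ge0 => x _; rewrite lee_fin powR_ge0.
have [J [J0 fJ JA]] := integral_finite_powR p1 fA.
have max_le u : gauge kd p lam (Num.max `|f u| J) <= `|f u| `^ p + J `^ p.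
  by apply: le_trans (gauge_max _ _ _ _ _) _; rewrite lerD // gauge_le_powR.
pose H (u : X) : \bar R := ((1 + `|D|)%:E * (`|f u| `^ p)%:E + (J `^ p)%:E)%E.
have D0 : 0 <= 1 + `|D| by rewrite addr_ge0.
have HE u : H u = ((1 + `|D|) * `|f u| `^ p + J `^ p)%:E by rewrite /H -EFinM -EFinD.
have H0 u : (0 <= H u)%E.
  by rewrite /H -EFinM -EFinD lee_fin addr_ge0 ?mulr_ge0 ?powR_ge0.
apply: (@le_trans _ _ (\int[mu]_y (gauge kd p lam (majorant vis f J y))%:E)%E).
  apply: ge0_le_integral => // x _; first exact: egauge_ge0.
  by rewrite -egauge_EFin egauge_mono // TU.
apply: (@le_trans _ _ (\int[mu]_y H y)%E).
  apply: le_integral_blocks => [x|//||k].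
  - by rewrite lee_fin gauge_ge0.
  - rewrite /H -EFinM -EFinD lee_fin; apply: le_trans (max_le None) _.
    by rewrite lerD2r ler_peMl ?powR_ge0 // lerDl.
  - have adm' : admissible kd p (block_part f (k := k)).
      move=> e; case: (adm e) => [|f01]; [by left|right=> x; rewrite /block_part].
      by case: (f01 (pt x)) => ->; rewrite ?normr0 ?normr1; [left|right].
    have := B k (block_part f (k := k)) lam l0 (fun x => normr_ge0 _) adm'.
    move=> /(ler_wpM2l (ltW (scale_gt0 (G := G) k))) Bk.
    under eq_bigr do rewrite -EFinM.
    under [X in (_ <= X)%E]eq_bigr do rewrite HE -EFinM.
    rewrite !sumEFin lee_fin.
    apply: (@le_trans _ _ (\sum_(x : block (G k)) (mass x * (`|f (pt x)| `^ p + J `^ p) +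
      scale (G := G) k * (block_mass x * \sum_(s | vis k x s)
         gauge kd p lam (cell_avg (block_part f (k := k)) s))))).
      apply: ler_sum => x _; rewrite /mass mulrA -mulrDr ler_wpM2l ?mass_ge0 //.
      apply: le_trans (gauge_sum _ _ _ _ _ _ _) _; rewrite lerD2r; exact: max_le.
    rewrite big_split /= -[X in _ + X]mulr_sumr.
    apply: le_trans (lerD (lexx _) Bk) _.
    have -> : scale (G := G) k * (D * \sum_(x : block (G k)) block_mass x * block_part f (k := k) x `^ p) =
        D * \sum_(x : block (G k)) mass x * `|f (pt x)| `^ p.
      rewrite mulrCA; congr (_ * _); rewrite mulr_sumr; apply: eq_bigr => x _.
      by rewrite /mass mulrA.
    rewrite mulr_sumr -big_split /=; apply: ler_sum => x _.
    rewrite mulrCA -mulrDr ler_wpM2l ?mass_ge0 // mulrDl mul1r addrAC lerD2r lerD2l.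
    by rewrite ler_wpM2r ?powR_ge0 // ler_norm.
rewrite /H ge0_integralD //.
rewrite ge0_integralZl_EFin //.
rewrite fA integral_cst //.
apply: (@le_trans _ _ ((1 + `|D|)%:E * A%:E + (J `^ p)%:E * 2%:E)%E).
  by rewrite leeD2l // lee_wpmul2l ?lee_fin ?powR_ge0 //; exact: measure_total.
rewrite -!EFinM -EFinD lee_fin [leRHS]mulrDl lerD2l mulrC -mulrA ler_wpM2l //.
by move=> x _; rewrite lee_fin powR_ge0.
Qed.

(** The first argument of [tagged_as] serves to cast the point into the type of block k once the
    tags agree. *)
Definition block_fun k (f : block (G k) -> R) (u : X) : R :=
  if u is Some t then
    if tag t == k then f (tagged_as (Tagged (fun k => block (G k)) (inl (hub0 (G k)) : block (G k))) t)
    else 0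
  else 0.

Lemma block_fun_pt k (f : block (G k) -> R) x : block_fun f (pt x) = f x.
Proof. by rewrite /block_fun /= eqxx tagged_asE. Qed.

Lemma block_fun_diff k (f : block (G k) -> R) j (x : block (G j)) :
  j != k -> block_fun f (pt x) = 0.
Proof. by rewrite /block_fun /= => /negPf ->. Qed.

Lemma block_fun_or (Q : R -> Prop) k (f : block (G k) -> R) u :
  Q 0 -> (forall x, Q (f x)) -> Q (block_fun f u).
Proof. by move=> Q0 Qf; case: u => [[j x]|] //=; case: ifP. Qed.

(** Test functions live on the hubs of one block, whose scale cancels; at a leaf the operator
    dominates the cell average, at least a third of the transfer. *)
Lemma gauge_type_lower (T : (X -> R) -> X -> \bar R) (S : pred nat) kd p : 1 <= p ->
  (forall f k (s : leaf (G k)), S k ->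
    ((cell_avg (block_part f (k := k)) s)%:E <= T f (pt (inr (inl s) : block (G k))))%E) ->
  gauge_type T kd p -> exists C, forall k, S k -> transfer_bound kd p C (G k).
Proof.
move=> p1 TL [C B]; have p_gt0 : 0 < p := lt_le_trans ltr01 p1.
have p_ge0 := ltW p_gt0.
exists (3 `^ p * C) => k Sk f f0 adm lam l0.
pose F := block_fun (extend0 f).
have FE (x : block (G k)) : F (pt x) = extend0 f x by exact: block_fun_pt.
have int : (\int[mu]_y (`|F y| `^ p)%:E =
    (scale (G := G) k * \sum_h hmass h * f h `^ p)%:E)%E.
  rewrite (@integral_one_block _ _ k) //.
  - rewrite -(extend0_sum f p_gt0) mulr_sumr -sumEFin; apply: eq_bigr => x _.
    by rewrite FE ger0_norm ?extend0_ge0 // -EFinM /mass mulrA.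
  - by rewrite /F /= normr0 powR0 // gt_eqF.
  - by move=> j x jk; rewrite /F block_fun_diff // normr0 powR0 // gt_eqF.
have Fadm : admissible kd p F.
  move=> e; case: (adm e) => [|f01]; [by left|right=> u].
  apply: (@block_fun_or (fun r => r = 0 \/ r = 1)); first by left.
  by case=> [h|[s|s]] /=; [exact: f01|left|left].
have l30 : 0 < lam / 3 by rewrite divr_gt0 // ltr0n.
have fin : (\int[mu]_y (`|F y| `^ p)%:E < +oo)%E by rewrite int ltry.
have := B F fin Fadm _ l30; rewrite int -EFinM => le.
pose L (x : block (G k)) : R :=
  if x is inr (inl s) then gauge kd p (lam / 3) (cell_avg (extend0 f) s) else 0.
have bp : block_part F (k := k) = extend0 f.
  by apply/funext => x; rewrite /block_part FE ger0_norm // extend0_ge0.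
have e0 s : 0 <= cell_avg (extend0 f) s by apply: cell_avg_ge0; exact: extend0_ge0.
have : (\sum_x (mass x)%:E * (L x)%:E <= (C * (scale (G := G) k * \sum_h hmass h * f h `^ p))%:E)%E.
  apply: le_trans le; apply: le_trans (integral_ge_block k _); last by move=> x; exact: egauge_ge0.
  apply: lee_sum => x _; apply: lee_wpmul2l; first by rewrite lee_fin mass_ge0.
  case: x => [h|[s|s]] /=; [exact: egauge_ge0| |exact: egauge_ge0].
  rewrite -egauge_EFin egauge_mono ?lee_fin //.
  by rewrite -bp; exact: TL.
under eq_bigr do rewrite -EFinM.
rewrite sumEFin lee_fin => le2.
have {}le2 : \sum_(s : leaf (G k)) lmass s * gauge kd p (lam / 3) (cell_avg (extend0 f) s) <=
    C * \sum_h hmass h * f h `^ p.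
  rewrite -(ler_pM2l (scale_gt0 (G := G) k)) mulrCA; apply: le_trans le2.
  rewrite block_sum /L /=.
  rewrite [X in X + _]big1 ?add0r; last by move=> h _; rewrite mulr0.
  rewrite [X in _ + X]big1 ?addr0; last by move=> h _; rewrite mulr0.
  by rewrite mulr_sumr; apply: ler_sum => s _; rewrite /mass mulrA.
rewrite -mulrA; apply: le_trans (ler_wpM2l (powR_ge0 3 p) le2).
rewrite mulr_sumr; apply: ler_sum => s _.
rewrite mulrCA ler_wpM2l ?(ltW (lmass_gt0 s)) //.
rewrite -gaugeZ // ?ltr0n //; apply: gauge_mono => //; first exact: transfer_ge0.
exact: transfer_le_cell_avg.
Qed.

End GaugeType.

(** * The types of an operator as gauge inequalities *)

Section Types.
Context {R : realType} {G : nat -> gadget R}.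
Notation X := (space G).
Notation mu := (@space_measure R G).
Implicit Types (p lam C : R) (f : X -> R) (h : X -> \bar R) (T : (X -> R) -> X -> \bar R).

Lemma omeasE (A : set X) : omeas mu A = mu A.
Proof.
apply/eqP; rewrite eq_le; apply/andP; split.
  by apply: ereal_inf_lbound; exists A => //; split.
by apply: le_ereal_inf_tmp => _ [B [_ AB] <-]; apply: le_measure; rewrite ?inE.
Qed.

Lemma uintE h : (forall x, (0 <= h x)%E) -> uint mu h = (\int[mu]_y h y)%E.
Proof.
move=> h0; apply/eqP; rewrite eq_le; apply/andP; split.
  by apply: ereal_inf_lbound; exists h.
by apply: le_ereal_inf_tmp => _ [g [_ hg] <-]; apply: ge0_le_integral.
Qed.

Lemma pnorm_fin p h :
  pnorm mu p%:E h = ((\int[mu]_y (h y `^ p)) `^ p^-1)%E.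
Proof. by rewrite /pnorm uintE // => x; exact: poweR_ge0. Qed.

Lemma pnorm_absE p f :
  pnorm mu p%:E (absE f) = ((\int[mu]_y (`|f y| `^ p)%:E) `^ p^-1)%E.
Proof. by rewrite pnorm_fin. Qed.

Lemma in_Lp_fin p f : 0 < p ->
  in_Lp mu p%:E f <-> (\int[mu]_y (`|f y| `^ p)%:E < +oo)%E.
Proof.
move=> p0; rewrite /in_Lp pnorm_absE; split=> [[_]|lt].
  by apply: lty_poweRy; rewrite invr_eq0 gt_eqF.
by split=> //; exact: poweR_lty.
Qed.

Lemma root_le p C (x y : \bar R) : 0 < p -> (0 <= x)%E -> (0 <= y)%E ->
  (x `^ p^-1 <= C%:E * y `^ p^-1)%E -> (x <= (`|C| `^ p)%:E * y)%E.
Proof.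
move=> p0 x0 y0 le.
have rK (z : \bar R) : (0 <= z)%E -> ((z `^ p^-1) `^ p = z)%E.
  by move=> z0; rewrite -poweRrM mulVf ?gt_eqF // poweRe1.
rewrite -(rK x x0) -(rK y y0) -poweR_EFin -poweRM ?poweR_ge0 ?lee_fin //.
have c0 : (0 <= `|C|%:E * y `^ p^-1)%E by rewrite mule_ge0 ?poweR_ge0 ?lee_fin.
apply: gt0_ler_poweR; rewrite ?in_itv /= ?leey ?andbT ?poweR_ge0 // ?(ltW p0) //.
by apply: le_trans le _; rewrite lee_wpmul2r ?poweR_ge0 // lee_fin ler_norm.
Qed.

Lemma le_root p C (x y : \bar R) : 0 < p -> (0 <= x)%E -> (0 <= y)%E ->
  (x <= C%:E * y)%E -> (x `^ p^-1 <= (`|C| `^ p^-1)%:E * y `^ p^-1)%E.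
Proof.
move=> p0 x0 y0 le.
rewrite -poweR_EFin -poweRM ?lee_fin //.
have c0 : (0 <= `|C|%:E * y)%E by rewrite mule_ge0 ?lee_fin.
apply: gt0_ler_poweR; rewrite ?in_itv /= ?leey ?andbT ?invr_ge0 ?(ltW p0) //.
by apply: le_trans le _; rewrite lee_wpmul2r // lee_fin ler_norm.
Qed.

Lemma integral_pow_ge0 p f : (0 <= \int[mu]_y (`|f y| `^ p)%:E)%E.
Proof. by apply: integral_ge0 => x _; rewrite lee_fin powR_ge0. Qed.

Lemma integral_level p lam h :
  (\int[mu]_y egauge Weak p lam (h y) = (lam `^ p)%:E * mu [set y | (lam%:E < h y)%E])%E.
Proof.
rewrite -integral_cst // [RHS]integral_mkcond; apply: eq_integral => y _.
by rewrite patchE /=; case: ifPn => hy; [rewrite mem_set|rewrite memNset //; apply/negP].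
Qed.

Lemma level_root p lam (A : set X) : 0 < p -> 0 < lam ->
  (lam%:E * mu A `^ p^-1 = ((lam `^ p)%:E * mu A) `^ p^-1)%E.
Proof.
move=> p0 l0; rewrite poweRM ?measure_ge0 ?lee_fin ?powR_ge0 //.
by rewrite poweR_EFin -powRrM mulfV ?gt_eqF // powRr1 // ltW.
Qed.

Lemma strong_typeE T p : 0 < p -> (forall f u, (0 <= T f u)%E) ->
  strong_type mu T p%:E <-> gauge_type T Strong p.
Proof.
move=> p0 T0; split=> [[C B]|[C B]].
  exists (`|C| `^ p) => f fin _ lam _.
  have := B f (proj2 (in_Lp_fin f p0) fin); rewrite pnorm_fin pnorm_absE.
  apply: root_le => //; last exact: integral_pow_ge0.
  by apply: integral_ge0 => x _; exact: poweR_ge0.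
exists (`|C| `^ p^-1) => f /(in_Lp_fin f p0) fin; rewrite pnorm_fin pnorm_absE.
apply: le_root => //; last 1 first.
- by apply: (B f fin _ 1).
- by apply: integral_ge0 => x _; exact: poweR_ge0.
- exact: integral_pow_ge0.
Qed.

Lemma weak_typeE T p : 0 < p ->
  weak_type mu T p%:E <-> gauge_type T Weak p.
Proof.
move=> p0; split=> [[C B]|[C B]].
  exists (`|C| `^ p) => f fin _ lam l0.
  have := B f (proj2 (in_Lp_fin f p0) fin) lam l0.
  rewrite pnorm_absE omeasE level_root // integral_level.
  apply: root_le => //; last exact: integral_pow_ge0.
  by rewrite mule_ge0 ?measure_ge0 // lee_fin powR_ge0.
exists (`|C| `^ p^-1) => f /(in_Lp_fin f p0) fin lam l0.
rewrite pnorm_absE omeasE level_root //.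
apply: le_root => //; last 1 first.
- by rewrite -integral_level; apply: B.
- by rewrite mule_ge0 ?measure_ge0 // lee_fin powR_ge0.
- exact: integral_pow_ge0.
Qed.

Lemma indic_pow p (E : set X) : 0 < p ->
  (\int[mu]_y (`|Defs.indic E y| `^ p)%:E = mu E)%E.
Proof.
move=> p0; rewrite -[RHS]mul1e -integral_cst // [RHS]integral_mkcond.
apply: eq_integral => y _; rewrite patchE /Defs.indic; have [Ey|Ey] := pselect (E y).
  by rewrite (asboolT Ey) mem_set // normr1 powR1.
by rewrite (asboolF Ey) memNset // normr0 powR0 // gt_eqF.
Qed.

Lemma restricted_weak_typeE T p : 1 <= p ->
  restricted_weak_type mu T p%:E <-> gauge_type T Restr p.
Proof.
move=> p1; have p0 : 0 < p := lt_le_trans ltr01 p1.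
rewrite /restricted_weak_type; case: eqP => [e|ne].
  (* At p = 1 every function is admissible. *)
  rewrite weak_typeE //; split=> -[C B]; exists C => f fin _ lam l0.
    exact: (B f fin _ lam l0).
  by apply: (B f fin _ lam l0) => _; left.
split=> [[C B]|[C B]].
  exists (`|C| `^ p) => f fin adm lam l0.
  have f01 : forall x, f x = 0 \/ f x = 1 by case: (adm erefl).
  have fE : f = Defs.indic [set x | f x = 1].
    apply/funext => x; rewrite /Defs.indic /=; case: (f01 x) => fx; rewrite fx.
      by rewrite asboolF // => /esym/eqP; rewrite oner_eq0.
    by rewrite asboolT.
  have mE : mu [set x | f x = 1] = (\int[mu]_y (`|f y| `^ p)%:E)%E.
    by rewrite [in RHS]fE indic_pow.
  have := B [set x | f x = 1] (space_measurable _); rewrite -fE mE => /(_ fin lam l0).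
  rewrite omeasE level_root // (integral_level p lam (T f)).
  apply: root_le => //; last exact: integral_pow_ge0.
  by rewrite mule_ge0 ?measure_ge0 // lee_fin powR_ge0.
exists (`|C| `^ p^-1) => E _ Efin lam l0.
have adm : admissible Restr p (Defs.indic E).
  by move=> _; right=> x; rewrite /Defs.indic; case: ifP; [right|left].
rewrite omeasE level_root //.
apply: le_root; rewrite ?measure_ge0 //; last first.
  rewrite -integral_level -(indic_pow E p0).
  by apply: (B (Defs.indic E) _ adm lam l0); rewrite indic_pow.
by rewrite mule_ge0 ?measure_ge0 // lee_fin powR_ge0.
Qed.

(** Nonempty sets have positive measure, so essential bounds are pointwise bounds. *)
Lemma strong_type_pinfty T :
  (forall f M u, (forall v, `|f v| <= M) -> (T f u <= M%:E)%E) ->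
  strong_type mu T +oo%E.
Proof.
move=> TM; exists 1 => f _; rewrite mul1e /pnorm.
apply: le_ereal_inf => M /=; rewrite !omeasE => M0.
have E x : ~ (M < absE f x)%E.
  move=> lt; have : (0 < mu [set y | (M < absE f y)%E])%E by exact: (@measure_gt0 _ _ _ x).
  by rewrite M0 ltxx.
have -> : [set y | (M < T f y)%E] = set0; last exact: measure0.
apply/seteqP; split=> // y /=; apply/negP; rewrite -leNgt.
(* Infinite M: +oo bounds everything, and -oo contradicts [E] at the centre. *)
move: M M0 E => [M||] M0 E; last 2 first.
- exact: leey.
- by exfalso; apply: (E None); rewrite /absE ltNyr.
apply: TM => v; rewrite leNgt; apply/negP => lt; apply: (E v).
by rewrite /absE lte_fin.
Qed.

End Types.

(** * One space carrying both families *)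

Section Assembly.
Variable R : realType.
Variables Gc Gn : nat -> gadget R.

(** With [odd] as flag, the blocks of [Gc] have detached leaves and affect both operators, those of
    [Gn] only the noncentered one. *)
Definition merge (k : nat) : gadget R := if odd k then Gc k./2 else Gn k./2.

Notation X := (space merge).
Notation mu := (@space_measure R merge).
Notation rho := (@rho R merge odd).

Lemma merge_odd k : merge k.*2.+1 = Gc k.
Proof. by rewrite /merge /= odd_double /= uphalf_double. Qed.

Lemma merge_even k : merge k.*2 = Gn k.
Proof. by rewrite /merge odd_double doubleK. Qed.

Lemma Mcent_ge0 (f : X -> R) (u : X) : (0 <= Mcent rho mu f u)%E.
Proof. by apply: le_trans (Mcent_norm odd f u); rewrite lee_fin. Qed.

Lemma Mnoncent_ge0 (f : X -> R) (u : X) : (0 <= Mnoncent rho mu f u)%E.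
Proof. by apply: le_trans (Mnoncent_norm odd f u); rewrite lee_fin. Qed.

(** In an even block only companions see cells from the centre of a ball, which costs the extra 1 in
    the constant whatever [Gn] is. *)
Lemma Mcent_gauge_type kd p : 1 <= p ->
  gauge_type (Mcent rho mu) kd p <-> uniform_bound kd p Gc.
Proof.
move=> p1; split=> [gt|[C B]].
  have [C B] := gauge_type_lower (S := odd) p1 (fun f k s => @Mcent_ge_cell _ _ odd f k s) gt.
  exists C => k; have := B k.*2.+1; rewrite merge_odd; apply.
  by rewrite /= odd_double.
pose D := 3 * 2 `^ p * (`|C| + 2 `^ p) : R.
have D0 : 0 <= D by rewrite mulr_ge0 ?mulr_ge0 ?addr_ge0 ?powR_ge0.
apply: (@gauge_type_upper _ _ _ (@cvis _ _ odd) _ _ (D + 1)) => //.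
- exact: Mcent_ge0.
- by move=> f J u; exact: Mcent_le.
move=> k f lam l0 f0 adm.
have S0 : 0 <= \sum_x block_mass x * f x `^ p.
  by apply: sumr_ge0 => x _; rewrite mulr_ge0 ?powR_ge0 // ltW // block_mass_gt0.
rewrite mulrDl mul1r; have [ok|ev] := boolP (odd k).
  apply: (@le_trans _ _ (D * \sum_x block_mass x * f x `^ p)); last by rewrite lerDl.
  apply: visible_bound => //; last first.
    by case=> [h|[s|s]] s' //= /andP[].
  by rewrite /merge ok.
apply: (@le_trans _ _ (\sum_x block_mass x * f x `^ p)); last by rewrite lerDr mulr_ge0.
apply: visible_comp_bound => // -[h|[s|s]] s' //=; rewrite ?(negPf ev) ?andbF //.
by move=> /andP[/eqP ->].
Qed.

(** Every cell is a ball about its companion and contains its leaf, so both families are felt. *)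
Lemma Mnoncent_gauge_type kd p : 1 <= p ->
  gauge_type (Mnoncent rho mu) kd p <-> uniform_bound kd p Gc /\ uniform_bound kd p Gn.
Proof.
move=> p1; split=> [gt|[[C1 B1] [C2 B2]]].
  have [C B] := gauge_type_lower (S := xpredT) p1 (fun f k s _ => @Mnoncent_ge_cell _ _ odd f k s) gt.
  by split; exists C => k; [rewrite -merge_odd|rewrite -merge_even]; exact: B.
pose D (C : R) : R := 3 * 2 `^ p * (`|C| + 2 `^ p).
have D0 C : 0 <= D C by rewrite mulr_ge0 ?mulr_ge0 ?addr_ge0 ?powR_ge0.
apply: (@gauge_type_upper _ _ _ (@nvis _ _) _ _ (D C1 + D C2)) => //.
- exact: Mnoncent_ge0.
- by move=> f J u; exact: Mnoncent_le.
move=> k f lam l0 f0 adm.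
have S0 : 0 <= \sum_x block_mass x * f x `^ p.
  by apply: sumr_ge0 => x _; rewrite mulr_ge0 ?powR_ge0 // ltW // block_mass_gt0.
have [ok|ev] := boolP (odd k).
  apply: (@le_trans _ _ (D C1 * \sum_x block_mass x * f x `^ p)); last first.
    by rewrite ler_wpM2r // lerDl.
  by apply: visible_bound => //; rewrite /merge ok.
apply: (@le_trans _ _ (D C2 * \sum_x block_mass x * f x `^ p)); last first.
  by rewrite ler_wpM2r // lerDr.
by apply: visible_bound => //; rewrite /merge (negPf ev).
Qed.

End Assembly.

Theorem theorem2p1p2 (R : realType) (Pcs Pcw Pcr Ps Pw Pr : set (\bar R)) :
  exp_set_form Pcs -> exp_set_form Pcw -> exp_set_form Pcr ->
  exp_set_form Ps -> exp_set_form Pw -> exp_set_form Pr ->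
  Ps `<=` Pcs -> Pw `<=` Pcw -> Pr `<=` Pcr ->
  Pcs `<=` Pcw -> Pcw `<=` Pcr -> Pcr `<=` closure Pcs ->
  Ps `<=` Pw -> Pw `<=` Pr -> Pr `<=` closure Ps ->
  (Pcr = full_range -> Pcw = full_range) ->
  (Pr = full_range -> Pw = full_range) ->
  exists (d : measure_display) (X : measurableType d)
         (rho : X -> X -> R) (mu : {measure set X -> \bar R}),
    [/\ metric_measure_space rho mu,
        ~ doubling rho mu,
        (forall p : \bar R, (1%:E <= p)%E ->
           [/\ strong_type mu (Mcent rho mu) p <-> Pcs p,
               weak_type mu (Mcent rho mu) p <-> Pcw p &
               restricted_weak_type mu (Mcent rho mu) p <-> Pcr p]) &
        (forall p : \bar R, (1%:E <= p)%E ->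
           [/\ strong_type mu (Mnoncent rho mu) p <-> Ps p,
               weak_type mu (Mnoncent rho mu) p <-> Pw p &
               restricted_weak_type mu (Mnoncent rho mu) p <-> Pr p])].
Proof.
move=> Fcs Fcw Fcr Fs Fw Fr csub wsub rsub sw_c wr_c rc_c sw wr rc full_c full.
have [Gc realc] := gadget_family Fcs sw_c wr_c rc_c full_c.
have [Gn realn] := gadget_family Fs sw wr rc full.
exists default_measure_display, (space (merge Gc Gn)), (rho odd),
  (@space_measure R (merge Gc Gn)).
have p_gt0 (p : R) : 1 <= p -> 0 < p by exact: lt_le_trans.
split; [exact: space_mms|exact: space_not_doubling| |].
- case=> [p||//] p1.
    rewrite lee_fin in p1.
    have E kd := iff_trans (Mcent_gauge_type Gc Gn kd p1) (realc kd p p1).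
    split.
    + exact: iff_trans (strong_typeE (p_gt0 p p1) (@Mcent_ge0 R Gc Gn)) (E Strong).
    + exact: iff_trans (weak_typeE _ (p_gt0 p p1)) (E Weak).
    + exact: iff_trans (restricted_weak_typeE _ p1) (E Restr).
  (* Averages never exceed a uniform bound, and each exponent set contains infinity by its form. *)
  have S : strong_type (@space_measure R (merge Gc Gn))
      (Mcent (rho odd) (@space_measure R (merge Gc Gn))) +oo%E.
    by apply: strong_type_pinfty; exact: Mcent_bounded.
  by split; split=> // _; exact: exp_set_form_pinfty.
- case=> [p||//] p1.
    rewrite lee_fin in p1.
    (* Each noncentered set lies in its centered counterpart, so the bound for [Gn] entails that for
       [Gc] and the conjunction reduces to [Gn]. *)
    have both kd : by_kind Ps Pw Pr kd `<=` by_kind Pcs Pcw Pcr kd by case: kd.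
    have E kd : gauge_type (Mnoncent (rho odd) (@space_measure R (merge Gc Gn))) kd p <->
        by_kind Ps Pw Pr kd p%:E.
      apply: iff_trans (Mnoncent_gauge_type Gc Gn kd p1) _.
      split=> [[_ /(realn kd p p1)]//|Pp]; split; first exact/(realc kd p p1)/both.
      exact/(realn kd p p1).
    split.
    + exact: iff_trans (strong_typeE (p_gt0 p p1) (@Mnoncent_ge0 R Gc Gn)) (E Strong).
    + exact: iff_trans (weak_typeE _ (p_gt0 p p1)) (E Weak).
    + exact: iff_trans (restricted_weak_typeE _ p1) (E Restr).
  have S : strong_type (@space_measure R (merge Gc Gn))
      (Mnoncent (rho odd) (@space_measure R (merge Gc Gn))) +oo%E.
    by apply: strong_type_pinfty; exact: Mnoncent_bounded.
  by split; split=> // _; exact: exp_set_form_pinfty.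
Qed.
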